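(* Assume the setting described in the context, assume for all $x\in[a,b]^{\ell_0}$ that $f(x)=f(0)$, let $(\gamma_n)_{n\in\mathbb N_0}\subseteq[0,\infty)$, let $(\Theta_n)_{n\in\mathbb N_0}\colon\mathbb N_0\to\mathbb R^{\mathfrak d}$ satisfy for all $n\in\mathbb N_0$ that $\Theta_{n+1}=\Theta_n-\gamma_n\mathcal G(\Theta_n)$, and assume $\sum_{n=0}^\infty\gamma_n=\infty$ and $$\sup_{n\in\mathbb N_0}(\gamma_n\mathfrak m)<\Big(L\mathbf a^2\Big[\prod_{p=0}^L(\ell_p+1)\Big](2V(\Theta_0)+4L^2\|f(0)\|^2+1)^{L-1}\Big)^{-1}.$$ Then (i) $\sup_{n\in\mathbb N_0}\|\Theta_n\|\le[2V(\Theta_0)+4L^2\|f(0)\|^2]^{1/2}<\infty$ and (ii) $\limsup_{n\to\infty}\mathcal L_\infty(\Theta_n)=0$.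
   Context: Setting. Let $L,\mathfrak d\in\mathbb N=\{1,2,\dots\}$, $(\ell_k)_{k\in\mathbb N_0}\subseteq\mathbb N$, $a\in\mathbb R$, $b\in(a,\infty)$, $\mathscr A\in(0,\infty)$, $\mathscr B\in(\mathscr A,\infty)$ with $\mathfrak d=\sum_{k=1}^L\ell_k(\ell_{k-1}+1)$; let $\mathbf a=\max\{|a|,|b|,1\}$ and $\mathbf d_k=\sum_{h=1}^k\ell_h(\ell_{h-1}+1)$ for $k\in\mathbb N_0$. For $\theta=(\theta_1,\dots,\theta_{\mathfrak d})\in\mathbb R^{\mathfrak d}$, $k\in\{1,\dots,L\}$, $i\in\{1,\dots,\ell_k\}$, $j\in\{1,\dots,\ell_{k-1}\}$ let $\mathfrak w^{k,\theta}_{i,j}=\theta_{(i-1)\ell_{k-1}+j+\mathbf d_{k-1}}$ and $\mathfrak b^{k,\theta}_i=\theta_{\ell_k\ell_{k-1}+i+\mathbf d_{k-1}}$, let $\mathfrak w^{k,\theta}=(\mathfrak w^{k,\theta}_{i,j})_{i,j}\in\mathbb R^{\ell_k\times\ell_{k-1}}$, $\mathfrak b^{k,\theta}=(\mathfrak b^{k,\theta}_1,\dots,\mathfrak b^{k,\theta}_{\ell_k})\in\mathbb R^{\ell_k}$, and $\mathcal A^\theta_k\colon\mathbb R^{\ell_{k-1}}\to\mathbb R^{\ell_k}$, $\mathcal A^\theta_k(x)=\mathfrak b^{k,\theta}+\mathfrak w^{k,\theta}x$. Let $\mathscr R_\infty(x)=\max\{x,0\}$ and let $\mathscr R_r\colon\mathbb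 R\to\mathbb R$, $r\in[1,\infty)$, satisfy for all $r\in[1,\infty)$: $\mathscr R_r\in C^1(\mathbb R,\mathbb R)$, $\mathscr R_r(x)=0$ for all $x\le\mathscr A r^{-1}$, $0\le\mathscr R_r(y)\le\max\{y,0\}$ for all $y\in\mathbb R$, $\mathscr R_r(z)=z$ for all $z\ge\mathscr B r^{-1}$; assume $\sup_{r\in[1,\infty)}\sup_{x\in\mathbb R}|(\mathscr R_r)'(x)|<\infty$. $\|\cdot\|$, $\langle\cdot,\cdot\rangle$ are the Euclidean norm and scalar product on each $\mathbb R^n$; for $r\in[1,\infty]$, $\mathfrak M_r(x_1,\dots,x_n)=(\mathscr R_r(x_1),\dots,\mathscr R_r(x_n))$. For $r\in[1,\infty]$, $\theta\in\mathbb R^{\mathfrak d}$ define $\mathcal N^{k,\theta}_r\colon\mathbb R^{\ell_0}\to\mathbb R^{\ell_k}$, $k\in\{1,\dots,L\}$, by $\mathcal N^{1,\theta}_r=\mathcal A^\theta_1$ and $\mathcal N^{k+1,\theta}_r(x)=\mathcal A^\theta_{k+1}(\mathfrak M_{r^{1/k}}(\mathcal N^{k,\theta}_r(x)))$ (with $\infty^{1/k}=\infty$). Let $\mu$ be a measure on the Borel $\sigma$-algebra of $[a,b]^{\ell_0}$ with $\mathfrak m=\mu([a,b]^{\ell_0})\in\mathbb R$, let $f=(f_1,\dots,f_{\ell_L})\colon\mathbb R^{\ell_0}\to\mathbb R^{\ell_L}$ be measurable (only its values on $[a,b]^{\ell_0}$ and the value $f(0)$ enter), and for $r\in[1,\infty]$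 let $\mathcal L_r\colon\mathbb R^{\mathfrak d}\to\mathbb R$ be given by $\mathcal L_r(\theta)=\int_{[a,b]^{\ell_0}}\|\mathcal N^{L,\theta}_r(x)-f(x)\|^2\,\mu(dx)$ (these integrals are real numbers as part of the setting). Let $\mathcal G\colon\mathbb R^{\mathfrak d}\to\mathbb R^{\mathfrak d}$ satisfy $\mathcal G(\theta)=\lim_{r\to\infty}(\nabla\mathcal L_r)(\theta)$ for every $\theta$ for which $((\nabla\mathcal L_r)(\theta))_{r\in[1,\infty)}$ is convergent as $r\to\infty$. Let $V\colon\mathbb R^{\mathfrak d}\to\mathbb R$, $V(\theta)=\big[\sum_{k=1}^L\big(k\|\mathfrak b^{k,\theta}\|^2+\sum_{i=1}^{\ell_k}\sum_{j=1}^{\ell_{k-1}}|\mathfrak w^{k,\theta}_{i,j}|^2\big)\big]-2L\langle f(0),\mathfrak b^{L,\theta}\rangle$. *)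

(* Defs.v *)
From HB Require Import structures.
From mathcomp Require Import all_boot all_order all_algebra.
From mathcomp Require Import all_classical all_reals all_analysis.
Set Implicit Arguments. Unset Strict Implicit. Unset Printing Implicit Defensive.
Import Order.TTheory GRing.Theory Num.Theory.
Import numFieldNormedType.Exports.
Local Open Scope classical_set_scope.
Local Open Scope ring_scope.

Section DNN.
Variable R : realType.

Definition dd (l : nat -> nat) (k : nat) : nat :=
  (\sum_(h < k) l h.+1 * (l h + 1))%N.

Definition thc (d : nat) (th : 'rV[R]_d) (n : nat) : R :=
  if insub n is Some m then th 0 m else 0.

(* 0-based weights/biases of the (k+1)-th affine layer (k+1 in 1..L):
   w^{k+1}_{i+1,j+1} = theta_{(i l_k + j + d_k) + 1} (1-based),
   b^{k+1}_{i+1} = theta_{(l_{k+1} l_k + i + d_k) + 1} (1-based). *)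
Definition wgt (l : nat -> nat) d (th : 'rV[R]_d) (k i j : nat) : R := thc th (i * l k + j + dd l k)%N.
Definition bia (l : nat -> nat) d (th : 'rV[R]_d) (k i : nat) : R := thc th (l k.+1 * l k + i + dd l k)%N.

(* vectors of R^{l_k} are represented as nat -> R (coordinates < l_k relevant) *)
Definition aff (l : nat -> nat) d (th : 'rV[R]_d) (k : nat) (v : nat -> R) : nat -> R :=
  fun i => bia l th k i + \sum_(j < l k) wgt l th k i j * v j.

(* realization: netS act k x = N^{k+1}(x); act h is the activation applied
   (componentwise) after layer h+1 *)
Fixpoint netS (l : nat -> nat) d (th : 'rV[R]_d) (act : nat -> R -> R) (k : nat)
    (x : 'rV[R]_(l 0%N)) : nat -> R :=
  match k with
  | 0 => aff l th 0 (fun j => if insub j is Some m then x 0 m else 0 : R)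
  | k'.+1 => aff l th k (fun j => act k' (@netS l d th act k' x j))
  end.

Definition relu (x : R) : R := Num.max x 0.
Definition actr (Rr : R -> R -> R) (r : R) : nat -> R -> R :=
  fun h => Rr (powR r (h.+1%:R)^-1).
Definition actinf : nat -> R -> R := fun _ => relu.

Definition box (n : nat) (a b : R) : set 'rV[R]_n :=
  [set x | forall i, a <= x 0 i <= b].

Definition BorelV (n : nat) := g_sigma_algebraType (@open 'rV[R]_n).

Definition sqerr (l : nat -> nat) L d (th : 'rV[R]_d) (act : nat -> R -> R) (f : 'rV[R]_(l 0%N) -> 'rV[R]_(l L))
   (x : 'rV[R]_(l 0%N)) : R :=
  \sum_(i < l L) (@netS l d th act L.-1 x i - f x 0 i) ^+ 2.

Definition loss (l : nat -> nat) L (a b : R) (mu : {measure set (BorelV (l 0%N)) -> \bar R}) (act : nat -> R -> R)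
   (f : 'rV[R]_(l 0%N) -> 'rV[R]_(l L)) (th : 'rV[R]_(dd l L)) : R :=
  fine (\int[mu]_(x in (@box (l 0%N) a b : set (BorelV (l 0%N)))) (@sqerr l L (dd l L) th act f x)%:E).

Definition grad d (F : 'rV[R]_d -> R) (th : 'rV[R]_d) : 'rV[R]_d :=
  \row_i ('D_(delta_mx 0 i) F th).

Definition enorm d (v : 'rV[R]_d) : R := Num.sqrt (\sum_(i < d) v 0 i ^+ 2).

Definition Vfun (l : nat -> nat) L (f0 : 'rV[R]_(l L)) (th : 'rV[R]_(dd l L)) : R :=
  \sum_(h < L) ((h.+1)%:R * \sum_(i < l h.+1) bia l th h i ^+ 2
                + \sum_(i < l h.+1) \sum_(j < l h) wgt l th h i j ^+ 2)
  - 2 * L%:R * \sum_(i < l L) f0 0 i * bia l th L.-1 i.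

End DNN.
Arguments netS {R} l {d} th act k x.
Arguments sqerr {R} l L {d} th act f x.
Arguments loss {R} l L a b mu act f th.
Arguments Vfun {R} l L f0 th.
Arguments box {R} n a b.
Arguments BorelV R n.

(* Main.v *)
(* Lyapunov descent.  For the ReLU network, moving the biases of layer [k] at
   rate [k] and all weights at rate [1] multiplies the output at rate [L]
   (infinitesimal homogeneity), so the generalized gradient [G] satisfies
   [<grad V, G> = 4 L * loss] exactly, [f] being constant on the box.  A layerwise energy
   estimate gives [|G|^2 <= 4 K m * loss] with [K] the constant of the step size
   condition, hence [V] decreases along the iteration by at least
   [c * gamma_n * loss_n], which bounds the iterates and makes
   [sum_n gamma_n * loss_n] finite.  The network is Lipschitz in its parameters,
   so [loss_{n+1} <= (1 + C gamma_n) loss_n], and with [sum_n gamma_n]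
   divergent the losses tend to [0].

   That [G] is the expected generalized gradient, with [ReLU'(0) = 0], comes from the radii
   [r^(1/k)]: the preactivations of layer [k] converge faster than the
   transition zone of the activation following them shrinks, so a vanishing limit
   preactivation is eventually in the flat part.  Differentiation under
   the integral and dominated convergence do the rest. *)
Require Import Defs.
From HB Require Import structures.
From mathcomp Require Import all_boot all_order all_algebra.
From mathcomp Require Import all_classical all_reals all_analysis.
From mathcomp Require Import measurable_realfun.
From mathcomp Require Import ring lra zify.
Import Order.TTheory GRing.Theory Num.Theory.
Import numFieldNormedType.Exports.
Local Open Scope classical_set_scope.
Local Open Scope ring_scope.

(** * Layerwise energy estimates *)

Section NetworkAlgebra.
Context {R : realType}.
Variables (l : nat -> nat).

Definition sqn (n : nat) (v : nat -> R) : R := \sum_(i < n) v i ^+ 2.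

Definition dot {d} (u v : 'rV[R]_d) : R := \sum_(n < d) u 0 n * v 0 n.

(** Squared Frobenius norm of the weight matrix augmented by the bias column. *)
Definition layer_sq {d} (th : 'rV[R]_d) (k : nat) : R :=
  \sum_(i < l k.+1) (bia l th k i ^+ 2 + \sum_(j < l k) wgt l th k i j ^+ 2).

Definition layer_in {d} (th : 'rV[R]_d) (act : nat -> R -> R) (k : nat)
    (x : 'rV[R]_(l 0%N)) : nat -> R :=
  if k is k'.+1 then fun j => act k' (netS l th act k' x j) else thc x.

(* Forward-mode derivative of the realization in the parameter direction [h]. *)
Fixpoint tanS {d} (th h : 'rV[R]_d) (act dact : nat -> R -> R) (k : nat)
    (x : 'rV[R]_(l 0%N)) : nat -> R :=
  fun i => aff l h k (layer_in th act k x) i +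
    (if k is k'.+1 then
       \sum_(j < l k) wgt l th k i j *
         (dact k' (netS l th act k' x j) * tanS th h act dact k' x j)
     else 0).

Lemma netSE {d} (th : 'rV[R]_d) act k x :
  netS l th act k x = aff l th k (layer_in th act k x).
Proof. by case: k. Qed.

Lemma thc_ord {d} (th : 'rV[R]_d) (n : 'I_d) : thc th n = th 0 n.
Proof. by rewrite /thc valK. Qed.

Lemma thc_out {d} (th : 'rV[R]_d) n : (d <= n)%N -> thc th n = 0.
Proof. by move=> h; rewrite /thc insubF// ltnNge h. Qed.

Lemma thc_lin {d} (c : R) (u v : 'rV[R]_d) n :
  thc (c *: u + v) n = c * thc u n + thc v n.
Proof. by rewrite /thc; case: insub => [m|]; rewrite ?mxE// mulr0 addr0. Qed.

Lemma aff_lin {d} (c : R) (u v : 'rV[R]_d) k y i :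
  aff l (c *: u + v) k y i = c * aff l u k y i + aff l v k y i.
Proof.
rewrite /aff /bia /wgt thc_lin mulrDr addrACA; congr (_ + _).
rewrite mulr_sumr -big_split/=.  apply: eq_bigr => j _.
by rewrite thc_lin mulrDl mulrA.
Qed.

Lemma tanS_lin {d} (th : 'rV[R]_d) c (u v : 'rV[R]_d) act dact k x i :
  tanS th (c *: u + v) act dact k x i =
  c * tanS th u act dact k x i + tanS th v act dact k x i.
Proof.
elim: k i => [|k IH] i; rewrite /= aff_lin; first by rewrite !addr0.
move: (aff l u _ _ _) (aff l v _ _ _) => Au Av.
rewrite mulrDr addrACA; congr (_ + _).
rewrite mulr_sumr -big_split/=; apply: eq_bigr => j _; rewrite IH; ring.
Qed.

Lemma tanS0 {d} (th : 'rV[R]_d) act dact k x i :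
  tanS th 0 act dact k x i = 0.
Proof. by have := tanS_lin th (-1) 0 0 act dact k x i; rewrite scaler0 addr0; lra. Qed.

Lemma tanS_sum {d} (th v : 'rV[R]_d) act dact k x i :
  tanS th v act dact k x i =
  \sum_(n < d) v 0 n * tanS th (delta_mx 0 n) act dact k x i.
Proof.
rewrite {1}(row_sum_delta v).
elim/big_rec2 : _ => [|n y z _ <-]; first by rewrite tanS0.
by rewrite tanS_lin.
Qed.

(** The cross term is controlled by [4 P Q (w v)^2 <= (P v^2 + Q w^2)^2]. Appending one coordinate
    in this way serves the induction for Cauchy-Schwarz and also adjoins the bias in [sqn_aff]. *)
Lemma cauchy_schwarz_step (X P Q w v : R) : 0 <= P -> 0 <= Q ->
  X ^+ 2 <= P * Q -> (X + w * v) ^+ 2 <= (P + w ^+ 2) * (Q + v ^+ 2).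
Proof.
move=> P0 Q0 XPQ.
suff : 2 * (X * (w * v)) <= P * v ^+ 2 + Q * w ^+ 2 by nra.
have Z0 : 0 <= P * v ^+ 2 + Q * w ^+ 2 by rewrite addr_ge0// mulr_ge0// sqr_ge0.
rewrite (le_trans (ler_norm _))// -(@ler_pXn2r _ 2)// ?nnegrE//.
rewrite real_normK ?num_real//.
have : X ^+ 2 * (w * v) ^+ 2 <= P * Q * (w * v) ^+ 2.
  by apply: ler_wpM2r => //; exact: sqr_ge0.
have := sqr_ge0 (P * v ^+ 2 - Q * w ^+ 2); nra.
Qed.

Lemma sqn_ge0 n v : 0 <= sqn n v.
Proof. by apply: sumr_ge0 => i _; exact: sqr_ge0. Qed.

Lemma cauchy_schwarz n (w v : nat -> R) :
  (\sum_(j < n) w j * v j) ^+ 2 <= sqn n w * sqn n v.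
Proof.
rewrite /sqn; elim: n => [|n IH]; first by rewrite !big_ord0 mul0r expr0n.
by rewrite !big_ord_recr/=; apply: cauchy_schwarz_step => //; exact: sqn_ge0.
Qed.

Lemma layer_sq_ge0 {d} (th : 'rV[R]_d) k : 0 <= layer_sq th k.
Proof. by apply: sumr_ge0 => i _; rewrite addr_ge0 ?sqr_ge0//; exact: sqn_ge0. Qed.

(** The bias acts as the weight of one extra input equal to [1], whence the factor [1 + sqn]. *)
Lemma sqn_aff {d} (th : 'rV[R]_d) k (y : nat -> R) :
  sqn (l k.+1) (aff l th k y) <= layer_sq th k * (1 + sqn (l k) y).
Proof.
rewrite /sqn /layer_sq mulr_suml; apply: ler_sum => i _.
have := @cauchy_schwarz_step (\sum_(j < l k) wgt l th k i j * y j)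
  _ _ (bia l th k i) 1 (sqn_ge0 _ _) (sqn_ge0 _ _) (cauchy_schwarz _ _ _).
by rewrite mulr1 expr1n /aff [bia _ _ _ _ + _]addrC [1 + _]addrC [_ ^+ 2 + _]addrC.
Qed.

Lemma sqn_wgt {d} (th : 'rV[R]_d) k (y : nat -> R) :
  sqn (l k.+1) (fun i => \sum_(j < l k) wgt l th k i j * y j)
  <= layer_sq th k * sqn (l k) y.
Proof.
rewrite /sqn /layer_sq mulr_suml; apply: ler_sum => i _.
apply: (le_trans (cauchy_schwarz _ _ _)).
by rewrite ler_wpM2r ?sqn_ge0// lerDr sqr_ge0.
Qed.

(** With [K = k.+1] the two sides differ by the sum of [(K u_i - v_i)^2 / K]. The division by [k.+1]
    cancels the factor [k.+1] of the induction hypothesis in [energy_bound], leaving [k.+2]. *)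
Lemma sqn_young n k (u v : nat -> R) :
  sqn n (fun i => u i + v i) <= k.+2%:R * (sqn n u + sqn n v / k.+1%:R).
Proof.
rewrite /sqn mulr_suml -big_split mulr_sumr; apply: ler_sum => i _ /=.
have k0 : 0 < k.+1%:R :> R by [].
have -> : k.+2%:R = k.+1%:R + 1 :> R by rewrite -natr1.
set K := k.+1%:R in k0 *.
rewrite -subr_ge0.
have -> : (K + 1) * (u i ^+ 2 + v i ^+ 2 / K) - (u i + v i) ^+ 2 =
  (K * u i - v i) ^+ 2 / K by field; rewrite gt_eqF.
by rewrite divr_ge0 ?sqr_ge0// ltW.
Qed.

(* With the input growth [1 + |y_k|^2 <= A T^k], the error recursion
   [D_{k+1} = A_h(y_{k+1}) + w e_k] costs one factor [T] per layer, and
   Young's inequality with weights [k+1, k+2] makes the constant linear in [k]. *)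
Lemma energy_bound {d} (th h : 'rV[R]_d) (y D e : nat -> nat -> R) (A T c : R) :
  0 <= A -> 1 <= T -> 1 <= c ->
  (forall k, layer_sq th k <= T) ->
  (forall k, 1 + sqn (l k) (y k) <= A * T ^+ k) ->
  (forall i, D 0%N i = aff l h 0 (y 0%N) i) ->
  (forall k i, D k.+1 i = aff l h k.+1 (y k.+1) i +
     \sum_(j < l k.+1) wgt l th k.+1 i j * e k j) ->
  (forall k, sqn (l k.+1) (e k) <= c * sqn (l k.+1) (D k)) ->
  forall k, sqn (l k.+1) (D k) <=
    k.+1%:R * (A * (c * T) ^+ k) * \sum_(j < k.+1) layer_sq h j.
Proof.
move=> A0 T1 c1 thT yA D0 DS eD.
have T0 : 0 <= T by exact: le_trans T1.
have c0 : 0 <= c by exact: le_trans c1.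
have haff k : sqn (l k.+1) (aff l h k (y k)) <= A * (c * T) ^+ k * layer_sq h k.
  apply: (le_trans (sqn_aff _ _ _)); rewrite mulrC ler_wpM2r ?layer_sq_ge0//.
  apply: (le_trans (yA k)); rewrite ler_wpM2l//.
  by rewrite lerXn2r// ?nnegrE ?mulr_ge0// ler_peMl.
elim=> [|k IH].
  rewrite big_ord1 mul1r.
  rewrite (_ : sqn _ _ = sqn (l 1%N) (aff l h 0 (y 0%N))).
    exact: haff.
  by apply: eq_bigr => i _; rewrite D0.
rewrite (_ : sqn _ _ = sqn (l k.+2) (fun i => aff l h k.+1 (y k.+1) i +
     \sum_(j < l k.+1) wgt l th k.+1 i j * e k j)); last first.
  by apply: eq_bigr => i _; rewrite DS.
apply: (le_trans (sqn_young _ k _ _)).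
(* The new layer accounts for the summand [layer_sq h k.+1]; the propagated error multiplies the
   induction hypothesis by [T] (weights) and [c] (passage from [D] to [e]). *)
rewrite -mulrA ler_wpM2l// big_ord_recr mulrDr addrC; apply: lerD; last exact: haff.
rewrite ler_pdivrMr// [leRHS]mulrC.
apply: (le_trans (sqn_wgt _ _ _)).
apply: (@le_trans _ _ (T * (c * sqn (l k.+1) (D k)))).
  by apply: ler_pM; rewrite ?layer_sq_ge0 ?sqn_ge0.
rewrite mulrCA mulrA; apply: le_trans (ler_wpM2l _ IH) _; first by rewrite mulr_ge0.
by rewrite exprS !mulrA [k.+1%:R * A * c]mulrAC [k.+1%:R * c]mulrC;
  rewrite le_eqVlt; apply/orP; left; apply/eqP; ring.
Qed.

(** [1 + |y_{k+1}|^2 <= (1 + layer_sq th k) (1 + |y_k|^2)]: keeping the [1] on both sides makes the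
    affine recursion multiplicative. *)
Lemma layer_in_growth {d} (th : 'rV[R]_d) act x (A T : R) :
  1 <= A -> (forall k, 1 + layer_sq th k <= T) -> (forall k z, `|act k z| <= `|z|) ->
  1 + sqn (l 0%N) (thc x) <= A ->
  forall k, 1 + sqn (l k) (layer_in th act k x) <= A * T ^+ k.
Proof.
move=> A1 thT actle xA; elim=> [|k IH]; first by rewrite mulr1.
have T1 : 1 <= T by apply: le_trans (thT 0%N); rewrite lerDl layer_sq_ge0.
have H : sqn (l k.+1) (layer_in th act k.+1 x) <=
    layer_sq th k * (1 + sqn (l k) (layer_in th act k x)).
  apply: le_trans (sqn_aff _ _ _); rewrite -netSE; apply: ler_sum => i _ /=.
  by rewrite -[leLHS]real_normK ?num_real// -[leRHS]real_normK ?num_real// lerXn2r ?nnegrE.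
apply: (@le_trans _ _ ((1 + layer_sq th k) * (1 + sqn (l k) (layer_in th act k x)))).
  by rewrite mulrDl mul1r lerD// lerDl sqn_ge0.
rewrite exprS mulrCA; apply: ler_pM => //.
  by rewrite addr_ge0// layer_sq_ge0.
by rewrite addr_ge0// sqn_ge0.
Qed.

End NetworkAlgebra.

(** * Parameter layout and the Lyapunov function *)

Section ParameterLayout.
Context {R : realType}.
Variables (l : nat -> nat).

Lemma ddS k : dd l k.+1 = (l k.+1 * l k + l k.+1 + dd l k)%N.
Proof. by rewrite /dd big_ord_recr/= mulnDr muln1 addnC. Qed.

Lemma dd_le k m : (k <= m)%N -> (dd l k <= dd l m)%N.
Proof.
move=> /subnK <-; elim: (m - k)%N => // n IH.
by rewrite addSn ddS (leq_trans IH)// leq_addl.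
Qed.

Lemma sum_mul_split (F : nat -> R) m n :
  \sum_(p < m * n) F p = \sum_(i < m) \sum_(j < n) F (i * n + j)%N.
Proof.
elim: m => [|m IH]; first by rewrite !big_ord0.
by rewrite big_ord_recr mulSnr big_split_ord/= IH.
Qed.

(** The layer blocks, each storing weights before biases, partition the parameter indices; inner
    products of parameters can thus be computed layerwise. *)
Lemma sum_layout (F : nat -> R) m :
  \sum_(n < dd l m) F n =
  \sum_(k < m) (\sum_(i < l k.+1) F (l k.+1 * l k + i + dd l k)%N +
    \sum_(i < l k.+1) \sum_(j < l k) F (i * l k + j + dd l k)%N).
Proof.
elim: m => [|m IH]; first by rewrite /dd !big_ord0.
rewrite ddS addnC big_split_ord big_ord_recr /= IH; congr (_ + _).
rewrite big_split_ord/= addrC; congr (_ + _).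
  by apply: eq_bigr => i _; rewrite addnC.
rewrite (sum_mul_split (fun p => F (dd l m + p)%N)).
by apply: eq_bigr => i _; apply: eq_bigr => j _; rewrite addnC.
Qed.

Lemma dot_layout L (u v : 'rV[R]_(dd l L)) :
  dot u v = \sum_(k < L) (\sum_(i < l k.+1) bia l u k i * bia l v k i +
    \sum_(i < l k.+1) \sum_(j < l k) wgt l u k i j * wgt l v k i j).
Proof.
rewrite -(sum_layout (fun n => thc u n * thc v n)).
by apply: eq_bigr => n _; rewrite !thc_ord.
Qed.

Lemma dot_ge0 d (u : 'rV[R]_d) : 0 <= dot u u.
Proof. by apply: sumr_ge0 => i _; rewrite -expr2 sqr_ge0. Qed.

Lemma sum_layer_sq d (u : 'rV[R]_d) m : \sum_(k < m) layer_sq l u k <= dot u u.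
Proof.
have -> : \sum_(k < m) layer_sq l u k = \sum_(n < dd l m) thc u n ^+ 2.
  rewrite (sum_layout (fun n => thc u n ^+ 2)).
  by apply: eq_bigr => k _; rewrite /layer_sq big_split.
have F0 n : 0 <= thc u n ^+ 2 by exact: sqr_ge0.
rewrite (_ : dot u u = \sum_(n < d) thc u n ^+ 2); last first.
  by apply: eq_bigr => n _; rewrite thc_ord expr2.
rewrite -!(big_mkord xpredT (fun n => thc u n ^+ 2)).
(* If [d] is the larger one, nonnegative terms are dropped; otherwise the surplus terms vanish,
   because [thc] reads [0] beyond the vector. *)
have [dm|md] := leqP d (dd l m); last first.
  by rewrite [leRHS](big_cat_nat _ (ltnW md))//= lerDl sumr_ge0.
rewrite (big_cat_nat _ dm)//= -[leRHS]addr0 lerD2l big_nat_cond big1//.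
by move=> n /andP[/andP[dn _] _]; rewrite thc_out ?expr0n.
Qed.

Lemma layer_sq_le d (u : 'rV[R]_d) k : layer_sq l u k <= dot u u.
Proof.
apply: le_trans (sum_layer_sq _ u k.+1); rewrite big_ord_recr/= lerDr.
by apply: sumr_ge0 => i _; exact: layer_sq_ge0.
Qed.

(** Inverse of the flat indexing: layers are peeled off from the last one, and quotient and
    remainder by the input width recover row and column of a weight. A parameter vector can then be
    prescribed layer by layer. *)
Fixpoint pack_coord (B : nat -> nat -> R) (W : nat -> nat -> nat -> R) L n : R :=
  if L is L'.+1 then
    if (n < dd l L')%N then pack_coord B W L' n else
    let p := (n - dd l L')%N in
    if (p < l L * l L')%N then W L' (p %/ l L')%N (p %% l L')%N
    else B L' (p - l L * l L')%N
  else 0.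

Definition pack B W L : 'rV[R]_(dd l L) := \row_n pack_coord B W L n.

Lemma pack_coord_mono B W L k n : (k <= L)%N -> (n < dd l k)%N ->
  pack_coord B W L n = pack_coord B W k n.
Proof.
elim: L => [|L IH]; first by rewrite leqn0 => /eqP ->.
rewrite leq_eqVlt => /predU1P[->//|]; rewrite ltnS => kL nk.
by rewrite /= (leq_trans nk) ?dd_le// IH.
Qed.

Lemma wgt_pos_lt k i j : (i < l k.+1)%N -> (j < l k)%N ->
  (i * l k + j < l k.+1 * l k)%N.
Proof. by move=> ik jk; nia. Qed.

Lemma thc_pack B W L k n : (k <= L)%N -> (n < dd l k)%N ->
  thc (pack B W L) n = pack_coord B W k n.
Proof.
move=> kL nk; have nL : (n < dd l L)%N by rewrite (leq_trans nk) ?dd_le.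
by rewrite -(@pack_coord_mono B W L)// /thc insubT mxE.
Qed.

Lemma bia_pack B W L k i : (k < L)%N -> (i < l k.+1)%N ->
  bia l (pack B W L) k i = B k i.
Proof.
move=> kL ik; rewrite /bia (@thc_pack _ _ _ k.+1)//; last first.
  by rewrite ddS ltn_add2r ltn_add2l.
by rewrite /= ltnNge leq_addl/= addnK ltnNge leq_addr/= addKn.
Qed.

Lemma wgt_pack B W L k i j : (k < L)%N -> (i < l k.+1)%N -> (j < l k)%N ->
  wgt l (pack B W L) k i j = W k i j.
Proof.
move=> kL ik jk; have p := wgt_pos_lt _ _ _ ik jk.
rewrite /wgt (@thc_pack _ _ _ k.+1)//; last first.
  by rewrite ddS ltn_add2r (leq_trans p) ?leq_addr.
rewrite /= ltnNge leq_addl/= addnK p modnMDl modn_small//.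
by rewrite divnMDl ?divn_small ?addn0// (leq_ltn_trans _ jk).
Qed.

End ParameterLayout.

(** * Gradient, coercivity and homogeneity of the Lyapunov function *)

Section Lyapunov.
Context {R : realType}.
Variables (l : nat -> nat) (L : nat) (xi : 'rV[R]_(l L.+1)).
Local Notation d := (dd l L.+1).
Implicit Types (th h : 'rV[R]_d).

Definition gradV_bia th (k i : nat) : R :=
  2 * k.+1%:R * bia l th k i - (if k == L then 2 * L.+1%:R * thc xi i else 0).

(** The Euclidean gradient of [V], certified algebraically by [Vfun_step]. *)
Definition gradV th : 'rV[R]_d :=
  pack l (gradV_bia th) (fun k i j => 2 * wgt l th k i j) L.+1.

Definition quadV th : R :=
  \sum_(k < L.+1) (k.+1%:R * \sum_(i < l k.+1) bia l th k i ^+ 2 +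
    \sum_(i < l k.+1) \sum_(j < l k) wgt l th k i j ^+ 2).

Lemma VfunE th : Vfun l L.+1 xi th = quadV th -
  2 * L.+1%:R * \sum_(i < l L.+1) thc xi i * bia l th L i.
Proof. by congr (_ - _ * _); apply: eq_bigr => i _; rewrite thc_ord. Qed.

Lemma quadV_le th : quadV th <= L.+1%:R * dot th th.
Proof.
rewrite dot_layout mulr_sumr; apply: ler_sum => k _; rewrite mulrDr lerD//.
  by rewrite ler_pM ?ler_nat ?sumr_ge0// => i _; rewrite sqr_ge0.
rewrite ler_peMl ?ler1n//.
  by apply: sumr_ge0 => i _; apply: sumr_ge0 => j _; rewrite sqr_ge0.
Qed.

(** [V] is a quadratic polynomial with homogeneous quadratic part [quadV], so its second-order
    expansion is exact. *)
Lemma Vfun_step th h (t : R) :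
  Vfun l L.+1 xi (th + t *: h) =
  Vfun l L.+1 xi th + t * dot (gradV th) h + t ^+ 2 * quadV h.
Proof.
have biaD k i : bia l (th + t *: h) k i = bia l th k i + t * bia l h k i.
  by rewrite /bia addrC thc_lin addrC.
have wgtD k i j : wgt l (th + t *: h) k i j = wgt l th k i j + t * wgt l h k i j.
  by rewrite /wgt addrC thc_lin addrC.
have -> : dot (gradV th) h = \sum_(k < L.+1)
     (2 * k.+1%:R * (\sum_(i < l k.+1) bia l th k i * bia l h k i) +
      2 * \sum_(i < l k.+1) \sum_(j < l k) wgt l th k i j * wgt l h k i j)
   - 2 * L.+1%:R * \sum_(i < l L.+1) thc xi i * bia l h L i.
  rewrite dot_layout !big_ord_recr/= -addrA; congr (_ + _).
    apply: eq_bigr => k _; congr (_ + _).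
      rewrite mulr_sumr; apply: eq_bigr => i _.
      rewrite bia_pack// ?(ltn_trans (ltn_ord k))// /gradV_bia.
      by rewrite (ltn_eqF (ltn_ord k)) subr0 mulrA.
    rewrite mulr_sumr; apply: eq_bigr => i _.
    rewrite mulr_sumr; apply: eq_bigr => j _.
    by rewrite wgt_pack// ?(ltn_trans (ltn_ord k))// mulrA.
  rewrite [RHS]addrAC; congr (_ + _).
    rewrite !mulr_sumr -sumrB; apply: eq_bigr => i _.
    by rewrite bia_pack// /gradV_bia eqxx; ring.
  rewrite mulr_sumr; apply: eq_bigr => i _.
  rewrite mulr_sumr; apply: eq_bigr => j _.
  by rewrite wgt_pack// mulrA.
rewrite !VfunE.
have -> : quadV (th + t *: h) = quadV th + t * (\sum_(k < L.+1)
     (2 * k.+1%:R * (\sum_(i < l k.+1) bia l th k i * bia l h k i) +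
      2 * \sum_(i < l k.+1) \sum_(j < l k) wgt l th k i j * wgt l h k i j))
    + t ^+ 2 * quadV h.
  rewrite /quadV !mulr_sumr -!big_split/=; apply: eq_bigr => k _.
  have -> : \sum_(i < l k.+1) bia l (th + t *: h) k i ^+ 2 =
    \sum_(i < l k.+1) bia l th k i ^+ 2 +
    2 * t * \sum_(i < l k.+1) bia l th k i * bia l h k i +
    t ^+ 2 * \sum_(i < l k.+1) bia l h k i ^+ 2.
    rewrite !mulr_sumr -!big_split/=; apply: eq_bigr => i _.
    by rewrite biaD; ring.
  have -> : \sum_(i < l k.+1) \sum_(j < l k) wgt l (th + t *: h) k i j ^+ 2 =
    \sum_(i < l k.+1) \sum_(j < l k) wgt l th k i j ^+ 2 +
    2 * t * (\sum_(i < l k.+1) \sum_(j < l k) wgt l th k i j * wgt l h k i j) +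
    t ^+ 2 * \sum_(i < l k.+1) \sum_(j < l k) wgt l h k i j ^+ 2.
    rewrite !mulr_sumr -!big_split/=; apply: eq_bigr => i _.
    rewrite !mulr_sumr -!big_split/=; apply: eq_bigr => j _.
    by rewrite wgtD; ring.
  ring.
have -> : \sum_(i < l L.+1) thc xi i * bia l (th + t *: h) L i =
    \sum_(i < l L.+1) thc xi i * bia l th L i +
    t * \sum_(i < l L.+1) thc xi i * bia l h L i.
  by rewrite mulr_sumr -big_split/=; apply: eq_bigr => i _; rewrite biaD; ring.
ring.
Qed.

(** In [2 V] the last bias [b] has weight [2 L.+1 >= 2]: one [|b|^2] absorbs the linear term by
    Young's inequality, at the cost [4 L.+1^2 |xi|^2], and another remains for the left side. *)
Lemma Vfun_coercive th :
  dot th th <= 2 * Vfun l L.+1 xi th + 4 * L.+1%:R ^+ 2 * dot xi xi.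
Proof.
rewrite VfunE dot_layout /quadV.
have xE : dot xi xi = \sum_(i < l L.+1) thc xi i ^+ 2.
  by apply: eq_bigr => i _; rewrite thc_ord.
rewrite xE !big_ord_recr/=.
set Lr : R := L.+1%:R.
have Lr1 : 1 <= Lr by rewrite ler1n.
set b := \sum_(i < l L.+1) bia l th L i ^+ 2.
set xb := \sum_(i < l L.+1) thc xi i * bia l th L i.
set x2 := \sum_(i < l L.+1) thc xi i ^+ 2.
have b0 : 0 <= b by apply: sumr_ge0 => i _; exact: sqr_ge0.
have yg : 4 * Lr * xb <= b + 4 * Lr ^+ 2 * x2.
  rewrite /xb /b /x2 !mulr_sumr -big_split; apply: ler_sum => i _ /=.
  by have := sqr_ge0 (bia l th L i - 2 * Lr * thc xi i); nra.
have wsq k : \sum_(i < l k.+1) \sum_(j < l k) wgt l th k i j * wgt l th k i j =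
    \sum_(i < l k.+1) \sum_(j < l k) wgt l th k i j ^+ 2 by [].
have bsq k : \sum_(i < l k.+1) bia l th k i * bia l th k i =
    \sum_(i < l k.+1) bia l th k i ^+ 2 by [].
have w0 k : 0 <= \sum_(i < l k.+1) \sum_(j < l k) wgt l th k i j ^+ 2.
  by apply: sumr_ge0 => i _; apply: sumr_ge0 => j _; exact: sqr_ge0.
rewrite ?bsq -?/b ?wsq.
set S1 := \sum_(k < L) _; set S2 := \sum_(k < L) _.
have S12 : S1 <= 2 * S2.
  rewrite /S1 /S2 mulr_sumr; apply: ler_sum => k _; rewrite bsq wsq mulrDr lerD//.
    rewrite mulrA ler_peMl//; first by apply: sumr_ge0 => i _; exact: sqr_ge0.
    by rewrite -natrM ler1n.
  by rewrite ler_peMl// ler1n.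
have := w0 L; set w := \sum_(i < l L.+1) _ => w0L.
have : 2 * b <= 2 * Lr * b by rewrite ler_wpM2r// ler_peMr.
rewrite -/Lr; nra.
Qed.

(* Rescaling layer [k] by [t] on weights and [t^(k+1)] on biases multiplies the
   [k]-th ReLU preactivation by [t^(k+1)]; this is the infinitesimal version. *)
Lemma tanS_gradV th x k i : (k <= L)%N -> (i < l k.+1)%N ->
  tanS l th (gradV th) (@actinf R) (fun _ y => (0 < y)%R%:R) k x i =
  2 * k.+1%:R * netS l th (@actinf R) k x i -
  (if k == L then 2 * L.+1%:R * thc xi i else 0).
Proof.
have affV k' y i' : (k' <= L)%N -> (i' < l k'.+1)%N ->
    aff l (gradV th) k' y i' = gradV_bia th k' i' +
      2 * \sum_(j < l k') wgt l th k' i' j * y j.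
  move=> kL il; rewrite /aff bia_pack//; congr (_ + _).
  by rewrite mulr_sumr; apply: eq_bigr => j _; rewrite wgt_pack// mulrA.
elim: k i => [|k IH] i kL il.
  rewrite /= affV// /gradV_bia addr0 /aff mulrDr mulr1.
  by rewrite addrAC.
rewrite [LHS]/= affV// /aff /gradV_bia.
rewrite (_ : \sum_(j < l k.+1) wgt l th k.+1 i j * (_ * tanS _ _ _ _ _ _ _ _) =
  2 * k.+1%:R * \sum_(j < l k.+1) wgt l th k.+1 i j *
    actinf k (netS l th (@actinf R) k x j)); last first.
  rewrite mulr_sumr; apply: eq_bigr => j _.
  (* Hidden layers carry no [xi] term, and [relu y] is [y] times the indicator of [0 < y], so the
     masked tangent is again a multiple of the activation. *)
  rewrite IH ?(ltnW kL)// (ltn_eqF kL) subr0 /actinf /relu.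
  case: ltP => [y0|y0]; first by rewrite mul1r; ring.
  by rewrite mul0r !mulr0.
(* Product rule: rate [2] of the weights plus rate [2 k.+1] of the inputs matches rate [2 k.+2] of
   the bias. *)
have -> : k.+2%:R = k.+1%:R + 1 :> R by rewrite -natr1.
rewrite [netS l th _ k.+1 x]netSE /aff /layer_in; ring.
Qed.

End Lyapunov.

(** * Bounds, measurability and derivatives of the network *)

Section NetworkBounds.
Context {R : realType}.
Variables (l : nat -> nat) (d : nat).
Implicit Types (th h : 'rV[R]_d) (x : 'rV[R]_(l 0%N)).

Lemma layer_sq_le1 th k : 1 + layer_sq l th k <= 1 + dot th th.
Proof. by rewrite lerD2l layer_sq_le. Qed.

Lemma netS_bound th act x (A : R) : 1 <= A ->
  (forall k z, `|act k z| <= `|z|) -> 1 + sqn (l 0%N) (thc x) <= A ->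
  forall k, sqn (l k.+1) (netS l th act k x) <= A * (1 + dot th th) ^+ k.+1.
Proof.
move=> A1 hact hA k.

have -> : sqn (l k.+1) (netS l th act k x) = sqn (l k.+1) (aff l th k (layer_in l th act k x)).
  by rewrite netSE.
apply: (le_trans (sqn_aff _ _ _ _)).
have g' := @layer_in_growth R l d th act x A (1 + dot th th) A1 (layer_sq_le1 th) hact hA k.
rewrite exprS mulrCA ler_pM ?layer_sq_ge0 ?addr_ge0 ?sqn_ge0//.
by rewrite (le_trans (layer_sq_le _ _ _ _))// lerDr.
Qed.

(** Instance of [energy_bound] in which [e] is the tangent times the activation derivative. The
    constant [c] will be [1] for ReLU and a bound uniform in [r] for the smoothed activations. *)
Lemma tanS_bound th h act dact x (A c : R) : 1 <= A -> 1 <= c ->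
  (forall k z, `|act k z| <= `|z|) -> (forall k z, dact k z ^+ 2 <= c) ->
  1 + sqn (l 0%N) (thc x) <= A ->
  forall k, sqn (l k.+1) (tanS l th h act dact k x) <=
    k.+1%:R * (A * (c * (1 + dot th th)) ^+ k) * dot h h.
Proof.
move=> A1 c1 hact hdact hA k.
have A0 : 0 <= A by exact: le_trans A1.
have T1 : 1 <= 1 + dot th th by rewrite lerDl dot_ge0.
apply: (@le_trans _ _ (k.+1%:R * (A * (c * (1 + dot th th)) ^+ k) *
    \sum_(j < k.+1) layer_sq l h j)); last first.
  rewrite ler_wpM2l ?sum_layer_sq//.
  by rewrite !mulr_ge0// exprn_ge0// mulr_ge0 ?(le_trans _ c1) ?(le_trans _ T1).
apply: (@energy_bound R l d th h (fun k => layer_in l th act k x)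
  (fun k => tanS l th h act dact k x)
  (fun k j => dact k (netS l th act k x j) * tanS l th h act dact k x j)) => //.
- by move=> j; rewrite (le_trans (layer_sq_le _ _ _ _))// lerDr.
- by apply: layer_in_growth => // j; exact: layer_sq_le1.
- by move=> i /=; rewrite addr0.
- move=> j; rewrite /sqn mulr_sumr; apply: ler_sum => i _.
  by rewrite exprMn ler_wpM2r ?sqr_ge0.
Qed.

(** [A_{th'}(y') - A_{th}(y) = A_{th' - th}(y') + w (y' - y)] has the shape of the tangent
    recursion, so [energy_bound] applies, with [c = 1] for nonexpansive activations. *)
Lemma netS_lipschitz th th' act x (A T : R) : 1 <= A ->
  (forall k z, `|act k z| <= `|z|) ->
  (forall k z z', `|act k z - act k z'| <= `|z - z'|) ->
  1 + sqn (l 0%N) (thc x) <= A -> 1 + dot th th <= T -> 1 + dot th' th' <= T ->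
  forall k, sqn (l k.+1) (fun i => netS l th' act k x i - netS l th act k x i) <=
    k.+1%:R * (A * T ^+ k) * dot (th' - th) (th' - th).
Proof.
move=> A1 hact hlip hA hT hT' k.
have A0 : 0 <= A by exact: le_trans A1.
have T1 : 1 <= T by apply: le_trans hT; rewrite lerDl dot_ge0.
apply: (@le_trans _ _ (k.+1%:R * (A * (1 * T) ^+ k) *
    \sum_(j < k.+1) layer_sq l (th' - th) j)); last first.
  by rewrite mul1r ler_wpM2l ?sum_layer_sq// !mulr_ge0// exprn_ge0// (le_trans _ T1).
have affB j y y' i : aff l th' j y' i - aff l th j y i =
   aff l (th' - th) j y' i + \sum_(n < l j) wgt l th j i n * (y' n - y n).
  have -> : aff l (th' - th) j y' i = aff l th' j y' i - aff l th j y' i.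
    by rewrite -scaleN1r addrC aff_lin mulN1r addrC.
  under eq_bigr do rewrite mulrBr.
  by rewrite sumrB /aff; ring.
apply: (@energy_bound R l d th (th' - th) (fun k => layer_in l th' act k x)
  (fun k i => netS l th' act k x i - netS l th act k x i)
  (fun k j => act k (netS l th' act k x j) - act k (netS l th act k x j))) => //.
- by move=> j; rewrite (le_trans (layer_sq_le _ _ _ _))// (le_trans _ hT)// lerDr.
- apply: layer_in_growth => // j.
  exact: le_trans (layer_sq_le1 _ _) hT'.
- move=> i; rewrite !netSE affB big1 ?addr0// => n _.
  by rewrite /= subrr mulr0.
- by move=> j i; rewrite [in LHS]netSE [in X in _ - X]netSE affB.
- move=> j; rewrite mul1r; apply: ler_sum => i _.
  by rewrite -[leLHS]real_normK ?num_real// -[leRHS]real_normK ?num_real// lerXn2r ?nnegrE.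
Qed.

End NetworkBounds.

(** * Borel measurability of the realization and its tangent *)

Section NetworkMeasurability.
Context {R : realType}.

Lemma open_measurable_BorelV n (U : set 'rV[R]_n) :
  open U -> measurable (U : set (BorelV R n)).
Proof. by move=> oU; exact: sub_sigma_algebra. Qed.

Lemma measurable_coord n (m : 'I_n) :
  measurable_fun setT (fun x : BorelV R n => (x : 'rV[R]_n) 0 m).
Proof.
apply: (measurability _ (RGenOpens.measurableE R)).
move=> _ [_ [a [b ->]] <-]; rewrite setTI.
apply: open_measurable_BorelV.
by apply: open_comp; [move=> x _; exact: coord_continuous|exact: interval_open].
Qed.

Lemma measurable_thc n k : measurable_fun setT (fun x : BorelV R n => thc (x : 'rV[R]_n) k).
Proof.
by rewrite /thc; case: insub => [m|]; [exact: measurable_coord|exact: measurable_cst].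
Qed.

Lemma measurable_box n (a b : R) : measurable (box n a b : set (BorelV R n)).
Proof.
have -> : (box n a b : set (BorelV R n)) =
    \bigcap_(i in [set: 'I_n]) ((fun x : BorelV R n => (x : 'rV[R]_n) 0 i) @^-1` `[a, b]).
  apply/seteqP; split => x /=; first by move=> xab i _; rewrite /= in_itv/=; exact: xab.
  by move=> xab i; have := xab i I; rewrite /= in_itv.
apply: fin_bigcap_measurable => // i _.
by rewrite -[X in measurable X]setTI; exact: measurable_coord.
Qed.

Variables (l : nat -> nat) (d : nat).
Implicit Types (th h : 'rV[R]_d).

Lemma measurable_netS th act k i : (forall k, measurable_fun setT (act k)) ->
  measurable_fun setT (fun x : BorelV R (l 0%N) => netS l th act k x i).
Proof.
move=> mact; elim: k i => [|k IH] i /=; rewrite /aff.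
  apply: measurable_funD => //; apply: measurable_sum => j.
  apply: measurable_funM => //; exact: (measurable_thc _ j).
apply: measurable_funD => //; apply: measurable_sum => j.
apply: measurable_funM => //.
by apply: measurableT_comp => //; exact: IH.
Qed.

Lemma measurable_tanS th h act dact k i :
  (forall k, measurable_fun setT (act k)) -> (forall k, measurable_fun setT (dact k)) ->
  measurable_fun setT (fun x : BorelV R (l 0%N) => tanS l th h act dact k x i).
Proof.
move=> mact mdact; elim: k i => [|k IH] i; rewrite /= /aff.
  apply: measurable_funD => //; apply: measurable_funD => //; apply: measurable_sum => j.
  apply: measurable_funM => //; exact: measurable_thc.
apply: measurable_funD.
  apply: measurable_funD => //; apply: measurable_sum => j.
  apply: measurable_funM => //.
  by apply: measurableT_comp => //; exact: measurable_netS.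
apply: measurable_sum => j; apply: measurable_funM => //; apply: measurable_funM => //.
by apply: measurableT_comp => //; exact: measurable_netS.
Qed.

End NetworkMeasurability.

(** * Differentiation along lines in parameter space *)

Section NetworkDerivative.
Context {R : realType}.
Variables (l : nat -> nat) (d : nat).
Implicit Types (th h : 'rV[R]_d).

Lemma is_derive_sum_pointwise n (F : 'I_n -> R -> R) (dF : 'I_n -> R) (t : R) :
  (forall i, is_derive t 1 (F i) (dF i)) ->
  is_derive t 1 (fun s => \sum_(i < n) F i s) (\sum_(i < n) dF i).
Proof.
move=> H; rewrite (_ : (fun s => _) = \sum_(i < n) F i).
  exact: is_derive_sum.
by apply/funext => s; rewrite fct_sumE.
Qed.

Lemma is_derive_add_pointwise (f g : R -> R) (df dg t : R) :
  is_derive t 1 f df -> is_derive t 1 g dg ->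
  is_derive t 1 (fun s => f s + g s) (df + dg).
Proof. by move=> Hf Hg; exact: (@is_deriveD _ _ _ f g). Qed.

Lemma is_derive_mul_pointwise (f g : R -> R) (df dg t : R) :
  is_derive t 1 f df -> is_derive t 1 g dg ->
  is_derive t 1 (fun s => f s * g s) (f t * dg + g t * df).
Proof. by move=> Hf Hg; exact: (@is_deriveM _ _ f g). Qed.

Lemma is_derive_thc th h n (t : R) :
  is_derive t 1 (fun s => thc (th + s *: h) n) (thc h n).
Proof.
rewrite (_ : (fun s => _) = (fun s => s * thc h n + thc th n)); last first.
  by apply/funext => s; rewrite addrC thc_lin.
rewrite -[thc h n in X in is_derive _ _ _ X]addr0.
apply: is_derive_add_pointwise.
have := is_derive_mul_pointwise id (cst (thc h n)) 1 0 t (is_derive_id t 1) (is_derive_cst _ _ _).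
by rewrite /= mulr0 add0r mulr1.
Qed.

Lemma is_derive_netS th h (act : nat -> R -> R) x k i (t : R) :
  (forall k z, derivable (act k) z 1) ->
  is_derive t 1 (fun s => netS l (th + s *: h) act k x i)
    (tanS l (th + t *: h) h act (fun k => derive1 (act k)) k x i).
Proof.
move=> dact; elim: k i => [|k IH] i.
  rewrite /= addr0 /aff; apply: is_derive_add_pointwise; first exact: is_derive_thc.
  apply: is_derive_sum_pointwise => j.
  rewrite -[wgt _ _ _ _ _ * _]add0r -[X in X + _](mulr0 (wgt l (th + t *: h) 0 i j)).
  rewrite [wgt _ h _ _ _ * _]mulrC.
  apply: is_derive_mul_pointwise; first exact: is_derive_thc.
rewrite [tanS _ _ _ _ _ _ _ _]/= /= /aff -addrA -big_split/=.
apply: is_derive_add_pointwise; first exact: is_derive_thc.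
apply: is_derive_sum_pointwise => j.
rewrite addrC [wgt _ h _ _ _ * _]mulrC.
apply: is_derive_mul_pointwise; first exact: is_derive_thc.
apply: (@is_derive1_comp _ (act k) _ _ _ _ _ (IH j)).
by apply: DeriveDef; [exact: dact|rewrite -derive1E].
Qed.

End NetworkDerivative.

(** * Convergence of the smoothed network *)

Section PowerLimits.
Context {R : realType}.

Lemma powR_cvgy (c : R) : 0 < c -> r `^ c @[r --> +oo] --> +oo.
Proof.
move=> c0; apply/cvgryPgt => M; near=> r.
have r1 : 1 <= r by near: r; apply: nbhs_pinfty_ge; rewrite num_real.
have M0 : 0 <= Num.max M 1 by rewrite le_max ler01 orbT.
apply: (@le_lt_trans _ _ (Num.max M 1)); first by rewrite le_max lexx.
rewrite -[ltLHS](powRr1 M0) -(@mulVf _ c) ?gt_eqF// powRrM.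
apply: gt0_ltr_powR => //; rewrite ?nnegrE ?powR_ge0 ?(le_trans ler01)//.
Unshelve. all: by end_near. Qed.

Lemma invk_gt0 (k : nat) : 0 < (k.+1%:R : R)^-1.
Proof. by rewrite invr_gt0. Qed.

Lemma root_ge1 (r : R) k : 1 <= r -> 1 <= r `^ (k.+1%:R)^-1.
Proof. by move=> r1; rewrite -[leLHS](powRr0 r); apply: ler_powR. Qed.

(** The exponent [1/(k+2) - 1/(k+1)] is negative: from one activation to the next the transition
    zone widens by an unbounded factor. *)
Lemma root_ratio_cvg0 k :
  (r `^ (k.+2%:R)^-1 / r `^ (k.+1%:R)^-1) @[r --> +oo] --> (0 : R).
Proof.
have c0 : 0 < (k.+1%:R)^-1 - (k.+2%:R)^-1 :> R.
  by rewrite subr_gt0 ltf_pV2 ?posrE// ltr_nat.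
have := powR_cvgy _ c0; rewrite -gtr0_cvgV0; last first.
  near=> r; apply: powR_gt0; near: r; apply: nbhs_pinfty_gt; exact: num_real.
apply: cvg_trans; apply: near_eq_cvg; near=> r.
have r0 : 0 < r by near: r; apply: nbhs_pinfty_gt; exact: num_real.
rewrite /= powRB ?(gt_eqF r0) ?implybT//.
by rewrite invfM invrK mulrC.
Unshelve. all: by end_near. Qed.

Lemma cvg_norm_squeeze0 (T : Type) (F : set_system T) (FF : Filter F) (f g : T -> R) :
  (\forall x \near F, `|f x| <= g x) -> g @ F --> (0 : R) -> f @ F --> (0 : R).
Proof.
move=> fg g0; apply: (@squeeze_cvgr _ _ _ _ (fun x => - g x) g) => //.
  by apply: filterS fg => x; rewrite ler_norml.
by rewrite -oppr0; exact: cvgN.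
Qed.

Lemma cvg_to_eq (T : Type) (F : set_system T) (f : T -> R) (a b : R) :
  a = b -> f @ F --> a -> f @ F --> b.
Proof. by move->. Qed.

Lemma cvg_sum_ord (T : Type) (F : set_system T) (FF : Filter F) n
    (f : nat -> T -> R) (a : nat -> R) :
  (forall i, f i @ F --> a i) ->
  (fun x => \sum_(i < n) f i x) @ F --> \sum_(i < n) a i.
Proof.
move=> fa; elim: n => [|n IH].
  by rewrite big_ord0; under eq_fun do rewrite big_ord0; exact: cvg_cst.
rewrite big_ord_recr; under eq_fun do rewrite big_ord_recr.
exact: cvgD.
Qed.

End PowerLimits.

(** * Smoothed activations approaching ReLU *)

Section ReluApproximation.
Context {R : realType}.
Variables (AA BB : R) (Rr : R -> R -> R).
Hypothesis AA0 : 0 < AA.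
Hypothesis ABB : AA < BB.
Hypothesis Rr_smooth : forall r, 1 <= r ->
  (forall x, derivable (Rr r) x 1) /\ continuous (derive1 (Rr r)).
Hypothesis Rr_low : forall r, 1 <= r -> forall x, x <= AA / r -> Rr r x = 0.
Hypothesis Rr_pos : forall r, 1 <= r -> forall y, 0 <= Rr r y <= Num.max y 0.
Hypothesis Rr_high : forall r, 1 <= r -> forall z, BB / r <= z -> Rr r z = z.

Lemma relu_ge0 (z : R) : 0 <= relu z.
Proof. by rewrite /relu le_max lexx orbT. Qed.

Lemma relu_le_norm (z : R) : relu z <= `|z|.
Proof. by rewrite /relu ge_max ler_norm normr_ge0. Qed.

Lemma relu_lipschitz (z z' : R) : `|relu z - relu z'| <= `|z - z'|.
Proof.
have h1 := ler_norm (z - z'); have h2 := ler_norm (z' - z); rewrite distrC in h2.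
rewrite ler_norml /relu; apply/andP; split; case: (leP z 0); case: (leP z' 0); lra.
Qed.

Lemma act_norm_le r z : 1 <= r -> `|Rr r z| <= `|z|.
Proof.
move=> r1; have /andP[h0 h1] := Rr_pos r r1 z.
by rewrite ger0_norm// (le_trans h1)// relu_le_norm.
Qed.

(** For [z] below [BB / r] both values lie in [[0, BB / r]]; from there on they coincide. *)
Lemma act_relu_dist r z : 1 <= r -> `|Rr r z - relu z| <= BB / r.
Proof.
move=> r1; have r0 : 0 < r by exact: lt_le_trans r1.
have B0 : 0 <= BB / r by rewrite divr_ge0 ?ltW// (lt_trans AA0).
have /andP[h0 h1] := Rr_pos r r1 z.
have [zB|Bz] := ltP z (BB / r).
  rewrite distrC ger0_norm ?subr_ge0// (@le_trans _ _ (relu z))//; first by lra.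
  by rewrite /relu ge_max (ltW zB).
by rewrite Rr_high// /relu max_l ?(le_trans B0)// subrr normr0.
Qed.

Lemma dact_low r z : 1 <= r -> z < AA / r -> derive1 (Rr r) z = 0.
Proof.
move=> r1 zA; rewrite derive1E -(@near_eq_derive _ _ _ (cst 0)) ?derive_cst//.
by near=> y; rewrite Rr_low//; apply: ltW; near: y; exact: lt_nbhsl.
Unshelve. all: by end_near. Qed.

Lemma dact_high r z : 1 <= r -> BB / r < z -> derive1 (Rr r) z = 1.
Proof.
move=> r1 zB; rewrite derive1E -(@near_eq_derive _ _ _ id) ?derive_id//.
by near=> y; rewrite Rr_high//; apply: ltW; near: y; exact: lt_nbhsr.
Unshelve. all: by end_near. Qed.

Variables (l : nat -> nat) (d : nat) (th : 'rV[R]_d) (x : 'rV[R]_(l 0%N)).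

Local Notation N_ r := (netS l th (actr Rr r)).
Local Notation Ninf := (netS l th (@actinf R)).
Local Notation dactr r := (fun k => derive1 (actr Rr r k)).
Local Notation dactinf := (fun (_ : nat) (y : R) => (0 < y)%R%:R : R).

(* The error of preactivation [k] is of order [r^(-1/k)], negligible against the
   width [r^(-1/(k+1))] of the transition zone of the next activation. *)
Lemma scaled_error_cvg0 k i :
  r `^ (k.+1%:R)^-1 * (N_ r k x i - Ninf k x i) @[r --> +oo] --> (0 : R).
Proof.
elim: k i => [|k IH] i.
  by under eq_fun do rewrite /= subrr mulr0; exact: cvg_cst.
under eq_fun => r.
  rewrite /= /aff opprD addrACA subrr add0r -sumrB mulr_sumr.
  under eq_bigr do rewrite -mulrBr mulrCA.
  over.
apply: (@cvg_to_eq _ _ _ _ (\sum_(j < l k.+1) 0)); first by rewrite big1.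
apply: (@cvg_sum_ord _ _ _ _ _ (fun j r => wgt l th k.+1 i j * (r `^ (k.+2%:R)^-1 *
  (actr Rr r k (N_ r k x j) - actinf k (Ninf k x j)))) (fun=> 0)) => j.
apply: (cvg_to_eq _ _ _ _ _ (mulr0 (wgt l th k.+1 i j))); apply: cvgMr.
(* Inserting [relu] of the smoothed preactivation bounds the activation error by [BB / s] plus the
   preactivation error, with [s] the radius at layer [k]. Factoring out [1 / s] leaves [ratio],
   which tends to [0], times a convergent quantity. *)
pose ratio (r : R) := r `^ (k.+2%:R)^-1 / r `^ (k.+1%:R)^-1.
apply: (@cvg_norm_squeeze0 _ _ _ _ _ (fun r => ratio r *
  (BB + `|r `^ (k.+1%:R)^-1 * (N_ r k x j - Ninf k x j)|))).
  near=> r.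
  have r1 : 1 <= r by near: r; apply: nbhs_pinfty_ge; exact: num_real.
  have s1 := root_ge1 r k r1.
  have s0 : 0 < r `^ (k.+1%:R)^-1 by exact: lt_le_trans s1.
  have t0 : 0 <= r `^ (k.+2%:R)^-1 by exact: powR_ge0.
  rewrite normrM (ger0_norm t0) /ratio -mulrA ler_wpM2l// normrM (ger0_norm (ltW s0)).
  rewrite mulrDr mulrA mulVf ?gt_eqF// mul1r.
  apply: (@le_trans _ _ (`|actr Rr r k (N_ r k x j) - relu (N_ r k x j)| +
    `|relu (N_ r k x j) - relu (Ninf k x j)|)); first by rewrite ler_distD.
  by rewrite lerD ?relu_lipschitz// mulrC act_relu_dist.
apply: (cvg_to_eq _ _ _ _ _ (mul0r (BB + 0))); apply: cvgM; first exact: root_ratio_cvg0.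
apply: cvgD; first exact: cvg_cst.
by apply: (cvg_to_eq _ _ _ _ _ (normr0 R)); apply: cvg_norm; exact: IH.
Unshelve. all: by end_near. Qed.

Lemma netS_cvg k i : N_ r k x i @[r --> +oo] --> Ninf k x i.
Proof.
apply/subr_cvg0; apply: (@cvg_norm_squeeze0 _ _ _ _ _
  (fun r => `|r `^ (k.+1%:R)^-1 * (N_ r k x i - Ninf k x i)|)).
  near=> r.
  have r1 : 1 <= r by near: r; apply: nbhs_pinfty_ge; exact: num_real.
  have s1 := root_ge1 r k r1.
  by rewrite normrM ler_peMl// ger0_norm// (le_trans _ s1).
by apply: (cvg_to_eq _ _ _ _ _ (normr0 R)); apply: cvg_norm; exact: scaled_error_cvg0.
Unshelve. all: by end_near. Qed.

Lemma act_netS_cvg k i :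
  actr Rr r k (N_ r k x i) @[r --> +oo] --> actinf k (Ninf k x i).
Proof.
apply/subr_cvg0; apply: (@cvg_norm_squeeze0 _ _ _ _ _
  (fun r => BB * (r `^ (k.+1%:R)^-1)^-1 + `|N_ r k x i - Ninf k x i|)).
  near=> r.
  have r1 : 1 <= r by near: r; apply: nbhs_pinfty_ge; exact: num_real.
  apply: (@le_trans _ _ (`|actr Rr r k (N_ r k x i) - relu (N_ r k x i)| +
    `|relu (N_ r k x i) - relu (Ninf k x i)|)); first by rewrite ler_distD.
  by rewrite lerD ?relu_lipschitz// act_relu_dist// root_ge1.
apply: (cvg_to_eq _ _ _ _ _ (addr0 0)); apply: cvgD.
  apply: (cvg_to_eq _ _ _ _ _ (mulr0 BB)); apply: cvgMr.
  apply/gtr0_cvgV0; last exact/powR_cvgy/invk_gt0.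
  by near=> r; apply: powR_gt0; near: r; apply: nbhs_pinfty_gt; exact: num_real.
by apply: (cvg_to_eq _ _ _ _ _ (normr0 R)); apply: cvg_norm; apply/subr_cvg0; exact: netS_cvg.
Unshelve. all: by end_near. Qed.

(** The two sides eventually agree: a positive limit preactivation puts the smoothed one above the
    transition zone, a nonpositive limit, zero included, puts it below. *)
Lemma dact_netS_cvg k i :
  dactr r k (N_ r k x i) @[r --> +oo] --> dactinf k (Ninf k x i).
Proof.
apply: cvg_near_cst; case: ltP => [y0|y0].
  near=> r.
  have r1 : 1 <= r by near: r; apply: nbhs_pinfty_ge; exact: num_real.
  rewrite dact_high ?root_ge1//.
  apply: (@lt_trans _ _ (Ninf k x i / 2)).
    rewrite ltr_pdivrMr ?(lt_le_trans _ (root_ge1 _ k r1))//.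
    rewrite -ltr_pdivrMl ?divr_gt0//; near: r.
    by move: (powR_cvgy _ (@invk_gt0 R k)) => /cvgryPgt; exact.
  near: r; apply: (cvgr_gt _ (netS_cvg k i)).
  by rewrite ltr_pdivrMr// ltr_pMr// ltr1n.
near=> r.
have r1 : 1 <= r by near: r; apply: nbhs_pinfty_ge; exact: num_real.
have s0 := lt_le_trans ltr01 (root_ge1 _ k r1).
rewrite dact_low ?root_ge1// ltr_pdivlMr// mulrC.
(* The limit preactivation is nonpositive here, so subtracting it only increases the value, and the
   scaled error tends to [0 < AA]. *)
apply: (@le_lt_trans _ _ (r `^ (k.+1%:R)^-1 * (N_ r k x i - Ninf k x i))).
  by rewrite ler_pM2l// lerBrDr gerDl.
near: r; exact: (cvgr_lt _ (scaled_error_cvg0 k i)).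
Unshelve. all: by end_near. Qed.

Lemma tanS_cvg h k i :
  tanS l th h (actr Rr r) (dactr r) k x i @[r --> +oo] -->
  tanS l th h (@actinf R) dactinf k x i.
Proof.
elim: k i => [|k IH] i; first by apply: cvg_near_cst; exact: nearW.
rewrite /= /aff; apply: cvgD.
  apply: cvgD; first exact: cvg_cst.
  apply: (@cvg_sum_ord _ _ _ _ _ (fun j r => wgt l h k.+1 i j * actr Rr r k (N_ r k x j))
    (fun j => wgt l h k.+1 i j * actinf k (Ninf k x j))) => j.
  by apply: cvgMr; exact: act_netS_cvg.
apply: (@cvg_sum_ord _ _ _ _ _ (fun j r => wgt l th k.+1 i j *
   (dactr r k (N_ r k x j) * tanS l th h (actr Rr r) (dactr r) k x j))
    (fun j => wgt l th k.+1 i j * (dactinf k (Ninf k x j) *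
       tanS l th h (@actinf R) dactinf k x j))) => j.
by apply: cvgMr; apply: cvgM; [exact: dact_netS_cvg|exact: IH].
Qed.

End ReluApproximation.

(** * Integrals of bounded functions *)

Section BoundedIntegrands.
Context {disp : measure_display} {T : measurableType disp} {R : realType}.
Variables (mu : {measure set T -> \bar R}) (D : set T).
Hypothesis mD : measurable D.
Hypothesis muD : (mu D < +oo)%E.
Implicit Types (g : T -> R).

Definition bounded_mfun g :=
  measurable_fun D g /\ exists M, forall x, D x -> `|g x| <= M.

Lemma bounded_mfun_integrable g :
  bounded_mfun g -> mu.-integrable D (EFin \o g).
Proof.
move=> [mg [M gM]]; apply: measurable_bounded_integrable => //.
exists M; split; first exact: num_real.
by move=> M' /ltW MM' x /= Dx; exact: le_trans (gM x Dx) MM'.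
Qed.

Lemma bounded_mfun_cst c : bounded_mfun (fun=> c).
Proof. by split; [exact: measurable_cst|exists `|c|]. Qed.

Lemma bounded_mfunD g1 g2 : bounded_mfun g1 -> bounded_mfun g2 ->
  bounded_mfun (fun x => g1 x + g2 x).
Proof.
move=> [m1 [M1 b1]] [m2 [M2 b2]]; split; first exact: measurable_funD.
by exists (M1 + M2) => x Dx; rewrite (le_trans (ler_normD _ _))// lerD ?b1 ?b2.
Qed.

Lemma bounded_mfunZ c g : bounded_mfun g -> bounded_mfun (fun x => c * g x).
Proof.
move=> [m [M b]]; split; first exact: measurable_funM.
by exists (`|c| * M) => x Dx; rewrite normrM ler_wpM2l ?b.
Qed.

Lemma bounded_mfun_sum (I : Type) (s : seq I) (c : I -> R) (g : I -> T -> R) :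
  (forall i, bounded_mfun (g i)) ->
  bounded_mfun (fun x => \sum_(i <- s) c i * g i x).
Proof.
move=> bg; elim: s => [|i s IH].
  by under eq_fun do rewrite big_nil; exact: bounded_mfun_cst.
under eq_fun do rewrite big_cons.
by apply: bounded_mfunD => //; exact: bounded_mfunZ.
Qed.

Lemma Rintegral_lincomb (I : Type) (s : seq I) (c : I -> R) (g : I -> T -> R) :
  (forall i, bounded_mfun (g i)) ->
  \int[mu]_(x in D) (\sum_(i <- s) c i * g i x) =
  \sum_(i <- s) c i * \int[mu]_(x in D) g i x.
Proof.
move=> bg; elim: s => [|i s IH].
  rewrite big_nil; under eq_Rintegral do rewrite big_nil.
  by rewrite Rintegral_cst// mul0r.
rewrite big_cons; under eq_Rintegral do rewrite big_cons.
rewrite RintegralD//; last 2 first.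
- exact/bounded_mfun_integrable/bounded_mfunZ.
- exact/bounded_mfun_integrable/bounded_mfun_sum.
by rewrite IH RintegralZl//; exact: bounded_mfun_integrable.
Qed.

Lemma le_Rintegral_lin g g1 (c1 M : R) :
  bounded_mfun g -> bounded_mfun g1 ->
  (forall x, D x -> g x <= c1 * g1 x + M) ->
  \int[mu]_(x in D) g x <= c1 * \int[mu]_(x in D) g1 x + M * fine (mu D).
Proof.
move=> bg bg1 h.
apply: (@le_trans _ _ (\int[mu]_(x in D) (c1 * g1 x + M))).
  apply: le_Rintegral => //; first exact: bounded_mfun_integrable.
  by apply: bounded_mfun_integrable; apply: bounded_mfunD;
    [exact: bounded_mfunZ|exact: bounded_mfun_cst].
rewrite RintegralD//; last 2 first.
- exact/bounded_mfun_integrable/bounded_mfunZ.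
- exact/bounded_mfun_integrable/bounded_mfun_cst.
by rewrite RintegralZl ?Rintegral_cst//; exact: bounded_mfun_integrable.
Qed.

Lemma bounded_cvg_Rintegral (F : R -> T -> R) (g : T -> R) (M : R) :
  (forall r, 1 <= r -> measurable_fun D (F r)) ->
  (forall r x, 1 <= r -> D x -> `|F r x| <= M) ->
  bounded_mfun g ->
  (forall x, D x -> F r x @[r --> +oo] --> g x) ->
  \int[mu]_(x in D) F r x @[r --> +oo] --> \int[mu]_(x in D) g x.
Proof.
move=> mF FM bg Fg; apply/cvg_pinftyP => u uy.
(* The bounds hold for [r >= 1] only; truncating the sequence from below changes finitely many
   terms. *)
pose v n := Num.max (u n) 1.
have v1 n : 1 <= v n by rewrite le_max lexx orbT.
have uv : \forall n \near \oo, v n = u n.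
  move/cvgryPge: uy => /(_ 1); apply: filterS => n un.
  by rewrite /v max_l.
have vy : v n @[n --> \oo] --> +oo.
  apply: cvg_trans uy; apply: near_eq_cvg.
  by apply: filterS uv => n ->.
suff H : \int[mu]_(x in D) F (v n) x @[n --> \oo] --> \int[mu]_(x in D) g x.
  apply: cvg_trans H; apply: near_eq_cvg.
  by apply: filterS uv => n ->.
apply: fine_cvg; rewrite fineK; last first.
  by apply: integrable_fin_num => //; exact: bounded_mfun_integrable.
have [|||||//] := @dominated_convergence _ T R mu D mD (fun n x => (F (v n) x)%:E)
  (EFin \o g) (cst M%:E).
- by move=> n; apply/measurable_EFinP; exact: mF.
- by apply/measurable_EFinP; exact: bg.1.
- apply: aeW => x Dx; apply: cvg_EFin; first exact: nearW.
  by move/cvg_pinftyP: (Fg x Dx); exact.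
- exact: bounded_mfun_integrable (bounded_mfun_cst M).
- by apply: aeW => x n Dx; rewrite lee_fin FM.
Qed.

End BoundedIntegrands.

(** * The squared residual *)

Section LossIntegrand.
Context {R : realType}.
Variables (l : nat -> nat) (L : nat) (xi : 'rV[R]_(l L.+1)).
Local Notation d := (dd l L.+1).
Implicit Types (th h : 'rV[R]_d) (x : 'rV[R]_(l 0%N)).

Definition residual th act x (i : nat) : R := netS l th act L x i - thc xi i.

Definition sqres th act x : R := sqn (l L.+1) (residual th act x).

Definition dsqres th h act dact x : R :=
  \sum_(i < l L.+1) 2 * residual th act x i * tanS l th h act dact L x i.

Lemma dsqres_lin_sum th v act dact x :
  dsqres th v act dact x =
  \sum_(n < d) v 0 n * dsqres th (delta_mx 0 n) act dact x.
Proof.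
rewrite /dsqres; under [RHS]eq_bigr do rewrite mulr_sumr.
rewrite exchange_big; apply: eq_bigr => i _ /=.
by rewrite tanS_sum mulr_sumr; apply: eq_bigr => n _; rewrite mulrCA.
Qed.

(** The weight [s] stays free: [s = 1] yields crude domination, while [gen_grad_sq_le] tunes it to
    absorb half of the squared gradient norm. *)
Lemma dsqres_young th h act dact x (s : R) : 0 < s ->
  `|dsqres th h act dact x| <=
  s * sqres th act x + s^-1 * sqn (l L.+1) (tanS l th h act dact L x).
Proof.
move=> s0; rewrite /dsqres /sqres /sqn !mulr_sumr -big_split/=.
apply: (le_trans (ler_norm_sum _ _ _)); apply: ler_sum => i _.
set u := residual _ _ _ _; set v := tanS _ _ _ _ _ _ _ _.
have H1 : 0 <= s^-1 * (s * u + v) ^+ 2 by rewrite mulr_ge0 ?invr_ge0 ?(ltW s0) ?sqr_ge0.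
have H2 : 0 <= s^-1 * (s * u - v) ^+ 2 by rewrite mulr_ge0 ?invr_ge0 ?(ltW s0) ?sqr_ge0.
have E1 : s^-1 * (s * u + v) ^+ 2 = s * u ^+ 2 + s^-1 * v ^+ 2 + 2 * u * v.
  by field; rewrite gt_eqF.
have E2 : s^-1 * (s * u - v) ^+ 2 = s * u ^+ 2 + s^-1 * v ^+ 2 - 2 * u * v.
  by field; rewrite gt_eqF.
by rewrite ler_norml; apply/andP; split; lra.
Qed.

Lemma sqres_ge0 th act x : 0 <= sqres th act x.
Proof. exact: sqn_ge0. Qed.

Lemma sqres_bound th act x (A T : R) : 1 <= A ->
  (forall k z, `|act k z| <= `|z|) -> 1 + sqn (l 0%N) (thc x) <= A ->
  1 + dot th th <= T ->
  sqres th act x <= 2 * (A * T ^+ L.+1) + 2 * sqn (l L.+1) (thc xi).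
Proof.
move=> A1 hact hA hT.
apply: (@le_trans _ _ (2 * sqn (l L.+1) (netS l th act L x) + 2 * sqn (l L.+1) (thc xi))).
  rewrite /sqres /sqn !mulr_sumr -big_split/=; apply: ler_sum => i _.
  by rewrite /residual; have := sqr_ge0 (netS l th act L x i + thc xi i); nra.
rewrite lerD2r ler_wpM2l//.
apply: (le_trans (netS_bound _ _ _ _ _ _ A1 hact hA L)).
rewrite ler_wpM2l ?(le_trans ler01 A1)// lerXn2r// nnegrE.
  by rewrite addr_ge0// dot_ge0.
by rewrite (le_trans _ hT)// addr_ge0// dot_ge0.
Qed.

Lemma dsqres_bound th h act dact x (A T c : R) : 1 <= A -> 1 <= c ->
  (forall k z, `|act k z| <= `|z|) -> (forall k z, dact k z ^+ 2 <= c) ->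
  1 + sqn (l 0%N) (thc x) <= A -> 1 + dot th th <= T ->
  `|dsqres th h act dact x| <=
  2 * (A * T ^+ L.+1) + 2 * sqn (l L.+1) (thc xi) + L.+1%:R * (A * (c * T) ^+ L) * dot h h.
Proof.
move=> A1 c1 hact hdact hA hT.
have A0 := le_trans ler01 A1; have c0 := le_trans ler01 c1.
have T0 : 0 <= 1 + dot th th by rewrite addr_ge0// dot_ge0.
apply: (le_trans (dsqres_young _ _ _ _ _ 1 ltr01)).
rewrite invr1 !mul1r lerD//; first exact: sqres_bound.
apply: (le_trans (tanS_bound _ _ _ _ _ _ _ _ _ A1 c1 hact hdact hA L)).
rewrite ler_wpM2r ?dot_ge0// ler_wpM2l// ler_wpM2l// lerXn2r ?nnegrE ?mulr_ge0//.
  exact: le_trans hT.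
by rewrite ler_wpM2l.
Qed.

Lemma measurable_sqres th act : (forall k, measurable_fun setT (act k)) ->
  measurable_fun setT (sqres th act : BorelV R (l 0%N) -> R).
Proof.
move=> mact; apply: measurable_sum => i; apply: measurable_funX.
by apply: measurable_funB => //; exact: measurable_netS.
Qed.

Lemma measurable_dsqres th h act dact :
  (forall k, measurable_fun setT (act k)) -> (forall k, measurable_fun setT (dact k)) ->
  measurable_fun setT (dsqres th h act dact : BorelV R (l 0%N) -> R).
Proof.
move=> mact mdact; apply: measurable_sum => i; apply: measurable_funM.
  by apply: measurable_funM => //; apply: measurable_funB => //; exact: measurable_netS.
exact: measurable_tanS.
Qed.

Lemma is_derive_sqres th h (act : nat -> R -> R) x (t : R) :
  (forall k z, derivable (act k) z 1) ->
  is_derive t 1 (fun s => sqres (th + s *: h) act x)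
    (dsqres (th + t *: h) h act (fun k => derive1 (act k)) x).
Proof.
move=> dact; apply: is_derive_sum_pointwise => i.
have Hr : is_derive t 1 (fun s => residual (th + s *: h) act x i)
    (tanS l (th + t *: h) h act (fun k => derive1 (act k)) L x i).
  rewrite -[tanS _ _ _ _ _ _ _ _]addr0; apply: is_derive_add_pointwise.
  exact: is_derive_netS.
have := is_derive_mul_pointwise _ _ _ _ _ Hr Hr.
rewrite (_ : _ + _ = 2 * residual (th + t *: h) act x i *
  tanS l (th + t *: h) h act (fun k => derive1 (act k)) L x i) //; ring.
Qed.

(** The extra [1] is absorbed by [1 <= m^2]. This bound corresponds to [abold ^+ 2] and the factor
    [l 0 + 1] in the step size condition. *)
Lemma box_input_bound (a b : R) x : box (l 0%N) a b x ->
  1 + sqn (l 0%N) (thc x) <=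
  (l 0%N).+1%:R * Num.max (Num.max `|a| `|b|) 1 ^+ 2.
Proof.
move=> xab; set m := Num.max _ 1.
have m1 : 1 <= m by rewrite le_max lexx orbT.
rewrite -natr1 mulrDl mul1r [leLHS]addrC lerD//; last by rewrite exprn_ege1.
rewrite mulr_natl -[X in _ *+ X]card_ord -sumr_const; apply: ler_sum => i _.
rewrite thc_ord -[leLHS]real_normK ?num_real// lerXn2r ?nnegrE ?(le_trans ler01 m1)//.
have /andP[ax xb] := xab i.
have hb : b <= m by rewrite !le_max ler_norm !orbT.
have ha : - a <= m by rewrite !le_max -normrN ler_norm.
by rewrite ler_norml; apply/andP; split; lra.
Qed.

End LossIntegrand.

(** * The generalized gradient *)

Section MatrixLimits.
Context {R : realType}.

Lemma cvg_row (T : Type) (F : set_system T) (FF : Filter F) n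
    (f : T -> 'rV[R]_n) (v : 'rV[R]_n) :
  (forall i, (fun t => f t 0 i) @ F --> v 0 i) -> f @ F --> v.
Proof.
move=> fv A [P vP PA]; apply: (@filterS _ F _ [set t | forall i, P 0 i (f t 0 i)]).
  by move=> t /= Pt; apply: PA => i j; rewrite ord1; exact: Pt.
by apply: filter_forall => i; exact: fv i _ (vP 0 i).
Qed.

End MatrixLimits.

Section LossGradient.
Context {R : realType}.
Variables (l : nat -> nat) (L : nat) (a b : R) (xi : 'rV[R]_(l L.+1)).
Variables (AA BB : R) (Rr : R -> R -> R).
Variable mu : {measure set (BorelV R (l 0%N)) -> \bar R}.
Variable f : 'rV[R]_(l 0%N) -> 'rV[R]_(l L.+1).
Hypothesis AA0 : 0 < AA.
Hypothesis ABB : AA < BB.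
Hypothesis Rr_smooth : forall r, 1 <= r ->
  (forall x, derivable (Rr r) x 1) /\ continuous (derive1 (Rr r)).
Hypothesis Rr_low : forall r, 1 <= r -> forall x, x <= AA / r -> Rr r x = 0.
Hypothesis Rr_pos : forall r, 1 <= r -> forall y, 0 <= Rr r y <= Num.max y 0.
Hypothesis Rr_high : forall r, 1 <= r -> forall z, BB / r <= z -> Rr r z = z.
Hypothesis Rr_dbound :
  exists C : R, forall r, 1 <= r -> forall x, `|(derive1 (Rr r)) x| <= C.
Hypothesis mu_fin : (mu (box (l 0%N) a b) < +oo)%E.
Hypothesis f_xi : forall x, box (l 0%N) a b x -> f x = xi.

Local Notation d := (dd l L.+1).
Implicit Types (th h : 'rV[R]_d).
Local Notation D := (box (l 0%N) a b : set (BorelV R (l 0%N))).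
Local Notation m := (fine (mu (box (l 0%N) a b))).
Local Notation A := ((l 0%N).+1%:R * Num.max (Num.max `|a| `|b|) 1 ^+ 2).
Local Notation T th := (1 + dot th th).
Local Notation dactr r := (fun k => derive1 (actr Rr r k)).
Local Notation dactinf := (fun (_ : nat) (y : R) => (0 < y)%R%:R : R).
Local Notation lossinf := (loss l L.+1 a b mu (@actinf R) f).

Let mD : measurable D. Proof. exact: measurable_box. Qed.

Let A1 : 1 <= A.
Proof. by rewrite mulr_ege1// ?ler1n// exprn_ege1// le_max lexx orbT. Qed.

Lemma mass_ge0 : 0 <= m. Proof. by rewrite fine_ge0. Qed.

Lemma lossE act th :
  loss l L.+1 a b mu act f th = \int[mu]_(x in D) sqres l L xi th act x.
Proof.
apply: eq_Rintegral => x; rewrite inE => Dx.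
by apply: eq_bigr => i _; rewrite f_xi// /residual thc_ord.
Qed.

Let actr_le r : 1 <= r -> forall k z, `|actr Rr r k z| <= `|z|.
Proof. by move=> r1 k z; rewrite act_norm_le// root_ge1. Qed.

Let actinf_le k (z : R) : `|actinf k z| <= `|z|.
Proof. by rewrite ger0_norm ?relu_ge0// relu_le_norm. Qed.

Let dactinf_le k z : dactinf k z ^+ 2 <= 1.
Proof. by rewrite /=; case: (0 < z) => /=; rewrite ?expr1n ?expr0n ?ler01. Qed.

Lemma measurable_actinf k : measurable_fun setT (@actinf R k).
Proof. by apply: measurable_maxr => //; exact: measurable_cst. Qed.

Lemma measurable_dactinf (k : nat) : measurable_fun setT (dactinf k).
Proof.
have -> : dactinf k = \1_(`]0, +oo[ : set R).
  by apply/funext => y; rewrite indicE mem_setE in_itv/= andbT.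
exact: measurable_indic.
Qed.

Let mactr r : 1 <= r -> forall k, measurable_fun setT (actr Rr r k).
Proof.
move=> r1 k; apply: continuous_measurable_fun => y.
apply/differentiable_continuous/derivable1_diffP.
by have [+ _] := Rr_smooth _ (root_ge1 _ k r1); exact.
Qed.

Let mdactr r : 1 <= r -> forall k, measurable_fun setT (dactr r k).
Proof.
move=> r1 k; apply: continuous_measurable_fun.
by have [_ +] := Rr_smooth _ (root_ge1 _ k r1); exact.
Qed.

Let dactr_le : exists2 c : R, 1 <= c &
  forall r, 1 <= r -> forall k z, dactr r k z ^+ 2 <= c.
Proof.
have [C HC] := Rr_dbound; exists (Num.max 1 (C ^+ 2)); first by rewrite le_max lexx.
move=> r r1 k z; rewrite le_max; apply/orP; right.
have H := HC _ (root_ge1 _ k r1) z.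
by rewrite -[leLHS]real_normK ?num_real// lerXn2r ?nnegrE// (le_trans _ H).
Qed.

Lemma bounded_sqres (act : nat -> R -> R) th : (forall k, measurable_fun setT (act k)) ->
  (forall k z, `|act k z| <= `|z|) -> bounded_mfun D (sqres l L xi th act).
Proof.
move=> mact hact; split.
  by apply: measurable_funTS; exact: measurable_sqres.
exists (2 * (A * T th ^+ L.+1) + 2 * sqn (l L.+1) (thc xi)) => x Dx.
rewrite ger0_norm ?sqres_ge0// (sqres_bound _ _ _ _ _ _ _ _ A1 hact)//.
exact: box_input_bound.
Qed.

Lemma bounded_dsqres (act dact : nat -> R -> R) th h (c : R) :
  (forall k, measurable_fun setT (act k)) -> (forall k, measurable_fun setT (dact k)) ->
  (forall k z, `|act k z| <= `|z|) -> 1 <= c -> (forall k z, dact k z ^+ 2 <= c) ->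
  bounded_mfun D (dsqres l L xi th h act dact).
Proof.
move=> mact mdact hact c1 hdact; split.
  by apply: measurable_funTS; exact: measurable_dsqres.
eexists => x Dx.
by apply: (dsqres_bound _ _ _ _ _ _ _ _ _ _ _ A1 c1 hact hdact) => //; exact: box_input_bound.
Qed.

Lemma bounded_dsqresinf th h : bounded_mfun D (dsqres l L xi th h (@actinf R) dactinf).
Proof.
exact: (bounded_dsqres _ _ _ _ 1 measurable_actinf measurable_dactinf).
Qed.

Lemma dot_line_le th h (t : R) : `|t| <= 1 ->
  T (th + t *: h) <= 1 + 2 * dot th th + 2 * dot h h.
Proof.
move=> t1; rewrite -addrA lerD2l /dot !mulr_sumr -big_split; apply: ler_sum => i _ /=.
rewrite !mxE.
have t2 : t ^+ 2 <= 1 by rewrite -real_normK ?num_real// expr_le1.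
have := sqr_ge0 (th 0 i - t * h 0 i); have := sqr_ge0 (h 0 i).
nra.
Qed.

Lemma loss_derive r th h : 1 <= r ->
  'D_h (loss l L.+1 a b mu (actr Rr r) f) th =
  \int[mu]_(x in D) dsqres l L xi th h (actr Rr r) (dactr r) x.
Proof.
move=> r1; have [c c1 hc] := dactr_le.
have dact k z : derivable (actr Rr r k) z 1.
  by have [+ _] := Rr_smooth _ (root_ge1 _ k r1); exact.
pose F (t : R) (x : BorelV R (l 0%N)) := sqres l L xi (th + t *: h) (actr Rr r) x.
have F1 t x : partial1of2 F t x =
    dsqres l L xi (th + t *: h) h (actr Rr r) (dactr r) x.
  by rewrite /partial1of2 derive1E; have [_ ->] := is_derive_sqres l L xi th h _ x t dact.
have In (t : R) : `]-1, 1[%classic t -> `|t| <= 1.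
  by rewrite /= in_itv/= => /andP[h1 h2]; rewrite ler_norml !ltW.
(* This is [dsqres_bound] with [T] taken from [dot_line_le], hence independent of [t] in []-1, 1[]
   and of [x] in the box: the dominating constant for differentiation under the integral. *)
pose M := 2 * (A * (1 + 2 * dot th th + 2 * dot h h) ^+ L.+1) +
  2 * sqn (l L.+1) (thc xi) +
  L.+1%:R * (A * (c * (1 + 2 * dot th th + 2 * dot h h)) ^+ L) * dot h h.
have FM (t : R) x : `]-1, 1[%classic t -> D x -> `|partial1of2 F t x| <= M.
  move=> It Dx; rewrite F1.
  apply: (dsqres_bound _ _ _ _ _ _ _ _ _ _ _ A1 c1 (actr_le r r1) (hc r r1)).
    exact: box_input_bound.
  exact: dot_line_le (In _ It).
have M0 : 0 <= M.
  have A0 : 0 <= A by exact: le_trans A1.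
  by rewrite !addr_ge0 ?mulr_ge0 ?exprn_ge0 ?addr_ge0 ?mulr_ge0 ?dot_ge0 ?sqn_ge0
    ?(le_trans ler01 c1)// addr_ge0 ?mulr_ge0 ?addr_ge0 ?mulr_ge0 ?dot_ge0.
have := @cvg_differentiation_under_integral R _ _ mu F D mD 0 (-1) 1.
move=> /(_ _ _ _ (cst M) _ _ FM) H.
rewrite /derive; apply/cvg_lim => //=.
have -> : (fun k : R => k^-1 *: (loss l L.+1 a b mu (actr Rr r) f (k *: h + th) -
    loss l L.+1 a b mu (actr Rr r) f th)) =
  (fun k => k^-1 *: (\int[mu]_(y in D) F (k + 0) y - \int[mu]_(y in D) F 0 y)).
  by apply/funext => k; rewrite !lossE /F addr0 scale0r addr0 [th + _]addrC.
have -> : \int[mu]_(x in D) dsqres l L xi th h (actr Rr r) (dactr r) x =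
    \int[mu]_(x in D) partial1of2 F 0 x.
  by apply: eq_Rintegral => x _; rewrite F1 scale0r addr0.
apply: H => //.
- by rewrite /= in_itv/= ltrN10 ltr01.
- move=> t _; apply: bounded_mfun_integrable => //.
  by apply: bounded_sqres; [exact: mactr|exact: actr_le].
- by move=> t x _ _; have [] := is_derive_sqres l L xi th h _ x t dact.
- by apply: bounded_mfun_integrable => //; exact: bounded_mfun_cst.
Qed.

(** Dominated convergence: the uniform bound on the activation derivatives makes the dominating
    constant independent of [r]. *)
Lemma loss_derive_cvg th h :
  'D_h (loss l L.+1 a b mu (actr Rr r) f) th @[r --> +oo] -->
  \int[mu]_(x in D) dsqres l L xi th h (@actinf R) dactinf x.
Proof.
have [c c1 hc] := dactr_le.
pose F r (x : BorelV R (l 0%N)) := dsqres l L xi th h (actr Rr r) (dactr r) x.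
suff : \int[mu]_(x in D) F r x @[r --> +oo] -->
    \int[mu]_(x in D) dsqres l L xi th h (@actinf R) dactinf x.
  apply: cvg_trans; apply: near_eq_cvg; near=> r.
  by rewrite loss_derive//; near: r; apply: nbhs_pinfty_ge; exact: num_real.
apply: (@bounded_cvg_Rintegral _ _ _ mu D mD mu_fin F _
  (2 * (A * T th ^+ L.+1) + 2 * sqn (l L.+1) (thc xi) +
   L.+1%:R * (A * (c * T th) ^+ L) * dot h h)).
- move=> r r1; apply: measurable_funTS.
  by apply: measurable_dsqres; [exact: mactr|exact: mdactr].
- move=> r x r1 Dx.
  apply: (dsqres_bound _ _ _ _ _ _ _ _ _ _ _ A1 c1 (actr_le r r1) (hc r r1)) => //.
  exact: box_input_bound.
- exact: bounded_dsqresinf.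
- move=> x Dx; apply: (@cvg_sum_ord _ _ _ _ _ (fun i r =>
    2 * residual l L xi th (actr Rr r) x i * tanS l th h (actr Rr r) (dactr r) L x i)
    (fun i => 2 * residual l L xi th (@actinf R) x i *
      tanS l th h (@actinf R) dactinf L x i)) => i.
  apply: cvgM; last exact: (tanS_cvg AA BB).
  apply: cvgMr; apply: cvgB; last exact: cvg_cst.
  exact: (netS_cvg AA BB).
Unshelve. all: by end_near. Qed.

Definition gen_grad th : 'rV[R]_d :=
  \row_n \int[mu]_(x in D) dsqres l L xi th (delta_mx 0 n) (@actinf R) dactinf x.

(** Convergence holds at every parameter, so a [G] prescribed only at points of convergence equals
    [gen_grad] everywhere. *)
Lemma grad_cvg th :
  (fun r : R => @grad R d (loss l L.+1 a b mu (actr Rr r) f) th) @ +oo --> gen_grad th.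
Proof.
apply: cvg_row => n; rewrite mxE; under eq_fun do rewrite mxE.
exact: loss_derive_cvg.
Qed.

Lemma dot_gen_grad h th :
  dot h (gen_grad th) = \int[mu]_(x in D) dsqres l L xi th h (@actinf R) dactinf x.
Proof.
under [RHS]eq_Rintegral do rewrite dsqres_lin_sum.
rewrite Rintegral_lincomb//; last by move=> n; exact: bounded_dsqresinf.
by apply: eq_bigr => n _; rewrite mxE.
Qed.

Lemma bounded_sqresinf th : bounded_mfun D (sqres l L xi th (@actinf R)).
Proof. exact: bounded_sqres measurable_actinf _. Qed.

Lemma lossinf_ge0 th : 0 <= lossinf th.
Proof. by rewrite lossE; apply: Rintegral_ge0 => x _; exact: sqres_ge0. Qed.

(** By [tanS_gradV] at the last layer, the output tangent along [gradV] is [2 L.+1] times the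
    residual, so the integrand is [4 L.+1] times the squared residual. *)
Lemma gradV_gen_grad th :
  dot (gradV l L xi th) (gen_grad th) = 4 * L.+1%:R * lossinf th.
Proof.
rewrite dot_gen_grad lossE -RintegralZl//; last first.
  by apply: bounded_mfun_integrable => //; exact: bounded_sqresinf.
apply: eq_Rintegral => x _.
rewrite /dsqres /sqres /sqn mulr_sumr; apply: eq_bigr => i _.
by rewrite tanS_gradV// eqxx /residual; ring.
Qed.

(** [X = |G|^2] is the generalized derivative of the risk in the direction [G] itself. Young's
    inequality and the tangent bound give [X <= s u + K m X / s], and [s = 2 K m] absorbs half of
    [X]. *)
Lemma gen_grad_sq_le th (K : R) : L.+1%:R * (A * T th ^+ L) <= K ->
  dot (gen_grad th) (gen_grad th) <= 4 * (K * m) * lossinf th.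
Proof.
move=> hK; set X := dot _ _; set u := lossinf th.
have u0 : 0 <= u by exact: lossinf_ge0.
have X0 : 0 <= X by exact: dot_ge0.
have K0 : 0 <= K.
  apply: le_trans hK; rewrite !mulr_ge0// ?(le_trans ler01 A1)//.
  by rewrite exprn_ge0// addr_ge0// dot_ge0.
have m0 := mass_ge0.
have XY s : 0 < s -> X <= s * u + s^-1 * (K * m) * X.
  move=> s0; rewrite {1}/X dot_gen_grad.
  have := @le_Rintegral_lin _ _ _ mu D mD mu_fin
    (dsqres l L xi th (gen_grad th) (@actinf R) dactinf)
    (sqres l L xi th (@actinf R)) s (s^-1 * (K * X))
    (bounded_dsqresinf _ _) (bounded_sqresinf _).
  rewrite -lossE -/u => H; apply: le_trans (H _) _; last first.
    by rewrite le_eqVlt; apply/orP; left; apply/eqP; ring.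
  move=> x Dx; apply: (le_trans (ler_norm _)).
  apply: (le_trans (dsqres_young _ _ _ _ _ _ _ _ _ s0)).
  rewrite lerD2l ler_wpM2l ?invr_ge0 ?(ltW s0)//.
  apply: (le_trans (tanS_bound _ _ _ _ _ _ _ _ _ A1 (lexx 1) actinf_le dactinf_le _ L)).
    exact: box_input_bound.
  by rewrite mul1r ler_wpM2r.
(* If [K m = 0], then [X <= s u] for every [s > 0], and [s = X / (2 (u + 1))] excludes [X > 0]. *)
have := mulr_ge0 K0 m0; rewrite le_eqVlt => /predU1P[Km0|Km0].
  rewrite -Km0 mulr0 mul0r leNgt; apply/negP => Xgt0.
  have u1 : 0 < 2 * (u + 1) by rewrite mulr_gt0// ltr_wpDl.
  have := XY (X / (2 * (u + 1))) (divr_gt0 Xgt0 u1).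
  rewrite -Km0 mulr0 mul0r addr0 mulrAC ler_pdivlMr// ler_pM2l//; lra.
set Q := K * m in XY Km0 *.
have -> : 4 * Q * u = 2 * (2 * Q * u) by ring.
have Q2 : 0 < 2 * Q by rewrite mulr_gt0.
have := XY _ Q2.
have -> : (2 * Q)^-1 * Q = 2^-1 by field; rewrite gt_eqF.
lra.
Qed.

(** Young's inequality with weights [1 + g] and [1 + g^-1]: the squared output difference carries
    [g^2], and [(1 + g^-1) g^2 = g (g + 1)] keeps a single factor [g] in front. *)
Lemma lossinf_step th h (g K : R) (P : R) :
  0 <= g -> 1 + dot th th <= P -> 1 + dot (th + g *: h) (th + g *: h) <= P ->
  L.+1%:R * (A * P ^+ L) <= K ->
  lossinf (th + g *: h) <= (1 + g) * lossinf th + g * ((g + 1) * (m * K * dot h h)).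
Proof.
move=> g0 hP hP' hK.
move: g0; rewrite le_eqVlt => /predU1P[<-|g0].
  by rewrite scale0r !addr0 mul0r addr0 mul1r.
rewrite !lossE.
have -> : g * ((g + 1) * (m * K * dot h h)) = (g * (g + 1) * K * dot h h) * m by ring.
apply: le_Rintegral_lin => //; [exact: bounded_sqresinf|exact: bounded_sqresinf|].
move=> x Dx.
have lip := netS_lipschitz _ _ th (th + g *: h) _ x _ _ A1 actinf_le
  (fun k => relu_lipschitz) (box_input_bound _ _ _ _ Dx) hP hP' L.
rewrite (addrC th) addrK in lip.
have E : dot (g *: h) (g *: h) = g ^+ 2 * dot h h.
  by rewrite /dot mulr_sumr; apply: eq_bigr => i _; rewrite !mxE; ring.
rewrite E in lip.
have lip2 := le_trans lip (ler_wpM2r (mulr_ge0 (sqr_ge0 g) (dot_ge0 _ h)) hK).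
apply: (@le_trans _ _ ((1 + g) * sqres l L xi th (@actinf R) x +
   (1 + g^-1) * (K * (g ^+ 2 * dot h h)))); last first.
  rewrite lerD2l le_eqVlt; apply/orP; left; apply/eqP; field.
  by rewrite gt_eqF.
have gi0 : 0 <= 1 + g^-1 by rewrite addr_ge0// invr_ge0 ltW.
apply: (@le_trans _ _ ((1 + g) * sqres l L xi th (@actinf R) x + (1 + g^-1) *
   sqn (l L.+1) (fun i => netS l (g *: h + th) (@actinf R) L x i -
     netS l th (@actinf R) L x i))); last first.
  by rewrite lerD2l ler_wpM2l.
rewrite [th + _]addrC /sqres /sqn !mulr_sumr -big_split; apply: ler_sum => i _ /=.
rewrite /residual; set n' := netS _ _ _ _ _ _; set n := netS _ th _ _ _ _.
rewrite -subr_ge0.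
have -> : (1 + g) * (n - thc xi i) ^+ 2 + (1 + g^-1) * (n' - n) ^+ 2 - (n' - thc xi i) ^+ 2
   = g^-1 * (g * (n - thc xi i) - (n' - n)) ^+ 2.
  by field; rewrite gt_eqF.
by rewrite mulr_ge0 ?sqr_ge0// invr_ge0 ltW.
Qed.

End LossGradient.

(** * Descent sequences *)

(* [u n - K \sum_(k < n) g k * u k] is nonincreasing, so [u] converges; its
   limit cannot be positive since [\sum_k g k * u k] is finite while [\sum_k g k] is not. *)
Lemma descent_cvg0 (R : realType) (V u g : nat -> R) (c M K : R) :
  0 < c -> 0 <= K -> (forall n, 0 <= g n) -> (forall n, 0 <= u n) ->
  (forall n, - M <= V n) ->
  (forall n, V n.+1 <= V n - c * (g n * u n)) ->
  (forall n, u n.+1 <= (1 + K * g n) * u n) ->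
  (\sum_(0 <= n <oo) (g n)%:E = +oo)%E ->
  u @ \oo --> (0 : R).
Proof.
move=> c0 K0 g0 u0 VM Vdec ugrow gdiv.
pose S n := \sum_(0 <= k < n) g k * u k.
have SS n : S n.+1 = S n + g n * u n by rewrite /S big_nat_recr.
have Sub n : S n <= (V 0%N + M) / c.
  rewrite ler_pdivlMr// [leLHS]mulrC.
  suff: V n <= V 0%N - c * S n by have := VM n; lra.
  elim: n => [|n IH]; first by rewrite /S big_geq// mulr0 subr0.
  by have := Vdec n; rewrite SS mulrDr; lra.
have Snd : {homo S : m n / (m <= n)%N >-> m <= n}.
  by apply/nondecreasing_seqP => n; rewrite SS lerDl mulr_ge0.
have cS : cvgn S.
  by apply: nondecreasing_is_cvgn => //; exists ((V 0%N + M) / c) => _ [n _ <-].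
pose w n := u n - K * S n.
have wni : {homo w : m n / (m <= n)%N >-> n <= m}.
  apply/nonincreasing_seqP => n; rewrite /w SS.
  by have := ugrow n; rewrite mulrDl mul1r mulrDr mulrA; lra.
have cw : cvgn w.
  apply: nonincreasing_is_cvgn => //.
  exists (- (K * ((V 0%N + M) / c))) => _ [n _ <-].
  by have := u0 n; have := ler_wpM2l K0 (Sub n); rewrite /w; lra.
have cu : cvgn u.
  have -> : u = (fun n => w n + K * S n) by apply/funext => n; rewrite /w subrK.
  by apply: is_cvgD => //; apply: is_cvgMr.
have lim0 : 0 <= limn u by apply: limr_ge => //; exact: nearW.
have [lu|lu] := eqVneq (limn u) 0; first by rewrite -lu.
have {lim0} lu0 : 0 < limn u by rewrite lt_neqAle eq_sym lu.
set e := limn u / 2.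
have e0 : 0 < e by rewrite divr_gt0.
have [N _ Nu] : \forall n \near \oo, e < u n.
  move/cvgrPdist_lt: cu => /(_ e e0); apply: filterS => n.
  by rewrite ltr_norml /e => /andP[_]; lra.
(* Past [N] every [u k] exceeds [e], so [g k <= g k * u k / e], and the partial sums of [g] would
   inherit the bound on [S]. *)
have gS n : \sum_(0 <= k < n) g k <= \sum_(0 <= k < N) g k + S n / e.
  have [nN|Nn] := leqP n N.
    rewrite -[leLHS]addr0 lerD//.
      by rewrite [leRHS](big_cat_nat _ nN)//= lerDl sumr_ge0.
    by rewrite divr_ge0 ?(ltW e0)// sumr_ge0// => k _; rewrite mulr_ge0.
  have -> : S n = S N + \sum_(N <= k < n) g k * u k.
    by rewrite /S (big_cat_nat _ (ltnW Nn)).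
  rewrite (big_cat_nat _ (ltnW Nn))//= lerD2l mulrDl.
  rewrite -[leLHS]add0r lerD//.
    by rewrite divr_ge0 ?(ltW e0)// sumr_ge0// => k _; rewrite mulr_ge0.
  rewrite mulr_suml big_nat_cond [leRHS]big_nat_cond ler_sum// => k /andP[/andP[Nk _] _].
  by rewrite ler_pdivlMr// ler_wpM2l// ltW// Nu.
have := gdiv.
suff : (\sum_(0 <= n <oo) (g n)%:E <=
    (\sum_(0 <= k < N) g k + ((V 0%N + M) / c) / e)%:E)%E.
  by move=> + H; rewrite H leye_eq.
apply: lime_le.
  by apply: is_cvg_nneseries => n _ _; rewrite lee_fin.
apply: nearW => n; rewrite sumEFin lee_fin (le_trans (gS n))// lerD2l.
by rewrite ler_wpM2r// ?invr_ge0 ltW.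
Qed.

(** * The gradient descent iteration *)

Section Descent.
Context {R : realType}.
Variables (l : nat -> nat) (L : nat) (a b : R).
Variable mu : {measure set (BorelV R (l 0%N)) -> \bar R}.
Variables (f : 'rV[R]_(l 0%N) -> 'rV[R]_(l L.+1)) (xi : 'rV[R]_(l L.+1)).
Hypothesis mu_fin : (mu (box (l 0%N) a b) < +oo)%E.
Hypothesis f_xi : forall x, box (l 0%N) a b x -> f x = xi.
Local Notation m := (fine (mu (box (l 0%N) a b))).
Local Notation A := ((l 0%N).+1%:R * Num.max (Num.max `|a| `|b|) 1 ^+ 2).
Local Notation u := (loss l L.+1 a b mu (@actinf R) f).
Local Notation G := (gen_grad l L a b xi mu).
Local Notation V := (Vfun l L.+1 xi).

Let A0 : 0 <= A.
Proof. by rewrite mulr_ge0// exprn_ge0// le_max ler01 orbT. Qed.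

Let K_mono (th : 'rV[R]_(dd l L.+1)) (P K : R) :
  1 + dot th th <= P -> L.+1%:R * (A * P ^+ L) <= K ->
  L.+1%:R * (A * (1 + dot th th) ^+ L) <= K.
Proof.
move=> hP; apply: le_trans; rewrite ler_wpM2l// ler_wpM2l//.
have T0 : 0 <= 1 + dot th th by rewrite addr_ge0// dot_ge0.
by rewrite lerXn2r// nnegrE// (le_trans T0).
Qed.

(** In the exact expansion of [V] the linear term equals [- 4 L.+1 g u], and the quadratic one is at
    most [4 L.+1 K (g m) g u] by the bound on [|G|^2]; then [g m <= s]. *)
Lemma Vfun_descent (th : 'rV[R]_(dd l L.+1)) (g P K s : R) :
  0 <= g -> g * m <= s -> 1 + dot th th <= P -> L.+1%:R * (A * P ^+ L) <= K ->
  V (th - g *: G th) <= V th - 4 * L.+1%:R * (1 - s * K) * (g * u th).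
Proof.
move=> g0 gs hP hK; have hK' := K_mono _ _ _ hP hK.
have K0 : 0 <= K.
  apply: le_trans hK'; rewrite mulr_ge0// mulr_ge0// exprn_ge0// addr_ge0//.
  exact: dot_ge0.
rewrite -scaleNr Vfun_step (gradV_gen_grad _ _ _ _ _ _ f)// sqrrN.
have u0 : 0 <= u th by exact: (lossinf_ge0 _ _ _ _ xi).
have X := gen_grad_sq_le l L a b xi mu f mu_fin f_xi th K hK'.
have Q : quadV l L (G th) <= L.+1%:R * (4 * (K * m) * u th).
  by apply: (le_trans (quadV_le _ _ _)); rewrite ler_wpM2l.
have H1 : g ^+ 2 * quadV l L (G th) <= g ^+ 2 * (L.+1%:R * (4 * (K * m) * u th)).
  by rewrite ler_wpM2l// sqr_ge0.
have H2 : 4 * L.+1%:R * (K * (g * u th)) * (g * m) <= 4 * L.+1%:R * (K * (g * u th)) * s.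
  by rewrite ler_wpM2l// mulr_ge0 ?mulr_ge0.
have E : g ^+ 2 * (L.+1%:R * (4 * (K * m) * u th)) =
    4 * L.+1%:R * (K * (g * u th)) * (g * m) by ring.
rewrite E in H1.
have -> : V th - 4 * L.+1%:R * (1 - s * K) * (g * u th) =
  V th + - g * (4 * L.+1%:R * u th) + 4 * L.+1%:R * (K * (g * u th)) * s by ring.
rewrite lerD2l; exact: le_trans H1 H2.
Qed.

(** Bounding [|G|^2] by a multiple of the risk makes the additive term of [lossinf_step]
    proportional to [u th]. Only [g m] is controlled, not [g], so [(g + 1) m] is estimated as a
    whole by [s + m]. *)
Lemma lossinf_growth (th : 'rV[R]_(dd l L.+1)) (g P K s : R) :
  0 <= g -> g * m <= s -> 1 + dot th th <= P ->
  1 + dot (th - g *: G th) (th - g *: G th) <= P -> L.+1%:R * (A * P ^+ L) <= K ->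
  u (th - g *: G th) <= (1 + (1 + (s + m) * (K * (4 * (K * m)))) * g) * u th.
Proof.
move=> g0 gs hP hP' hK; have hK' := K_mono _ _ _ hP hK.
have K0 : 0 <= K.
  apply: le_trans hK'; rewrite mulr_ge0// mulr_ge0// exprn_ge0// addr_ge0//.
  exact: dot_ge0.
have u0 : 0 <= u th by exact: (lossinf_ge0 _ _ _ _ xi).
have X := gen_grad_sq_le l L a b xi mu f mu_fin f_xi th K hK'.
have m0 := mass_ge0 l a b mu.
have XN : dot (- G th) (- G th) = dot (G th) (G th).
  by apply: eq_bigr => i _; rewrite !mxE mulrNN.
move: hP'; rewrite -scalerN => hP'.
have := lossinf_step l L a b xi mu f mu_fin f_xi th (- G th) g K P g0 hP hP' hK.
rewrite XN => /le_trans; apply.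
have H1 : g * ((g + 1) * (m * K * dot (G th) (G th))) <=
    g * ((g + 1) * (m * K * (4 * (K * m) * u th))).
  by rewrite ler_wpM2l// ler_wpM2l ?addr_ge0// ler_wpM2l// mulr_ge0.
have H2 : g * (K * (4 * (K * m) * u th)) * (g * m + m) <=
    g * (K * (4 * (K * m) * u th)) * (s + m).
  by rewrite ler_wpM2l ?lerD2r// !mulr_ge0.
have E : g * ((g + 1) * (m * K * (4 * (K * m) * u th))) =
   g * (K * (4 * (K * m) * u th)) * (g * m + m) by ring.
rewrite E in H1.
have -> : (1 + (1 + (s + m) * (K * (4 * (K * m)))) * g) * u th =
  (1 + g) * u th + g * (K * (4 * (K * m) * u th)) * (s + m) by ring.
by rewrite lerD2l; exact: le_trans H1 H2.
Qed.

End Descent.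

(** * Boundedness of the iterates and vanishing of the risk *)

Theorem theorem4p7 (R : realType) (L : nat) (l : nat -> nat) (a b AA BB : R)
    (Rr : R -> R -> R) (mu : {measure set (BorelV R (l 0%N)) -> \bar R})
    (f : 'rV[R]_(l 0%N) -> 'rV[R]_(l L))
    (G : 'rV[R]_(dd l L) -> 'rV[R]_(dd l L))
    (gamma : nat -> R) (Theta : nat -> 'rV[R]_(dd l L)) :
  (0 < L)%N -> (forall k, 0 < l k)%N ->
  a < b -> 0 < AA -> AA < BB ->
  (forall r, 1 <= r -> (forall x, derivable (Rr r) x 1) /\ continuous (derive1 (Rr r))) ->
  (forall r, 1 <= r -> forall x, x <= AA / r -> Rr r x = 0) ->
  (forall r, 1 <= r -> forall y, 0 <= Rr r y <= Num.max y 0) ->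
  (forall r, 1 <= r -> forall z, BB / r <= z -> Rr r z = z) ->
  (exists C : R, forall r, 1 <= r -> forall x, `|(derive1 (Rr r)) x| <= C) ->
  (mu (@box R (l 0%N) a b) < +oo)%E ->
  (forall i, measurable_fun setT (fun x : BorelV R (l 0%N) => f x 0 i)) ->
  (forall th : 'rV[R]_(dd l L),
     cvg ((fun r : R => @grad R (dd l L) (loss l L a b mu (actr Rr r) f) th) @ +oo) ->
     G th = lim ((fun r : R => @grad R (dd l L) (loss l L a b mu (actr Rr r) f) th) @ +oo)) ->
  (forall x, @box R (l 0%N) a b x -> f x = f 0) ->
  (forall n, 0 <= gamma n) ->
  (forall n, Theta n.+1 = Theta n - gamma n *: G (Theta n)) ->
  (\sum_(0 <= n <oo) (gamma n)%:E = +oo)%E ->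
  let m := fine (mu (@box R (l 0%N) a b)) in
  let abold := Num.max (Num.max `|a| `|b|) 1 in
  let f0sq := \sum_(i < l L) f 0 0 i ^+ 2 in
  let V0 := Vfun l L (f 0) (Theta 0%N) in
  (ereal_sup (range (fun n => (gamma n * m)%:E)) <
    ((L%:R * abold ^+ 2 * (\prod_(p < L.+1) (l p + 1)%:R)
      * (2 * V0 + 4 * L%:R ^+ 2 * f0sq + 1) ^+ L.-1)^-1)%:E)%E ->
  (ereal_sup (range (fun n => (@enorm R (dd l L) (Theta n))%:E))
     <= (Num.sqrt (2 * V0 + 4 * L%:R ^+ 2 * f0sq))%:E)%E
  /\ limn_esup (fun n => (loss l L a b mu (@actinf R) f (Theta n))%:E) = 0%E.
Proof.
case: L f G Theta => [//|L] f G Theta _ l0 ab AA0 ABB smooth low pos high dbound mufin _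
  Glim fconst g0 Thetastep gdiv m abold.
set xi := f 0 => f0sq V0 hsup.
have f_xi x : box (l 0%N) a b x -> f x = xi by exact: fconst.
have GE th : G th = gen_grad l L a b xi mu th.
  have H := grad_cvg l L a b xi AA BB Rr mu f AA0 ABB smooth low pos high dbound mufin f_xi th.
  rewrite Glim; last by apply/cvg_ex; eexists; exact: H.
  by apply/cvg_lim => //; exact: norm_hausdorff.
have f0E : f0sq = dot xi xi by apply: eq_bigr => i _; rewrite expr2.
pose V := Vfun l L.+1 xi; pose u := loss l L.+1 a b mu (@actinf R) f.
have coer th : dot th th <= 2 * V th + 4 * L.+1%:R ^+ 2 * f0sq.
  by rewrite f0E; exact: Vfun_coercive.
(* By coercivity this base of the power in the step size condition bounds [1 + |theta|^2] on the
   sublevel set [V <= V0]. *)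
set P := 2 * V0 + 4 * L.+1%:R ^+ 2 * f0sq + 1 in hsup.
have P1 : 1 <= P.
  by rewrite lerDr (le_trans _ (coer (Theta 0%N)))// dot_ge0.
have P0 := le_trans ler01 P1.
pose Pi : R := \prod_(p < L.+2) (l p + 1)%:R.
pose K := L.+1%:R * abold ^+ 2 * Pi * P ^+ L.
rewrite -[X in (_ < X)%E]/((K^-1)%:E) in hsup.
have ab1 : 1 <= abold by rewrite le_max lexx orbT.
(* The factor [p = 0] is the [l 0 + 1] of the input bound; the others are at least one. *)
have hPi : (l 0%N).+1%:R <= Pi.
  rewrite /Pi big_ord_recl addn1 ler_peMr//.
  by rewrite -natr_prod ler1n prodn_gt0// => i; rewrite addn1.
have hK : L.+1%:R * ((l 0%N).+1%:R * abold ^+ 2 * P ^+ L) <= K.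
  have -> : L.+1%:R * ((l 0%N).+1%:R * abold ^+ 2 * P ^+ L) =
    L.+1%:R * abold ^+ 2 * P ^+ L * (l 0%N).+1%:R by ring.
  have -> : K = L.+1%:R * abold ^+ 2 * P ^+ L * Pi by rewrite /K; ring.
  by rewrite ler_wpM2l// !mulr_ge0 ?exprn_ge0// (le_trans ler01).
have Kgt0 : 0 < K.
  have abgt0 := lt_le_trans ltr01 ab1; have Pgt0 := lt_le_trans ltr01 P1.
  by apply: lt_le_trans hK; rewrite !mulr_gt0// exprn_gt0.
clearbody K.
(* [s] is the supremum itself, finite because it lies between [gamma 0 * m] and [K^-1]. The strict
   inequality makes the descent constant [c] positive uniformly in [n]. *)
have [s sK hs] : exists2 s, s < K^-1 & forall n, gamma n * m <= s.
  set S := ereal_sup _ in hsup.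
  have hS n : ((gamma n * m)%:E <= S)%E by apply: ereal_sup_ubound; exists n.
  exists (fine S).
    by rewrite -lte_fin fineK// fin_numElt (lt_le_trans _ (hS 0%N)) ?ltNyr// (lt_trans hsup) ?ltry.
  move=> n; rewrite -lee_fin fineK//.
  by rewrite fin_numElt (lt_le_trans _ (hS 0%N)) ?ltNyr// (lt_trans hsup) ?ltry.
have sK1 : 0 < 1 - s * K by rewrite subr_gt0 -ltr_pdivlMr// div1r.
have m0 : 0 <= m by exact: mass_ge0.
have s0 : 0 <= s by apply: le_trans (hs 0%N); rewrite mulr_ge0.
have u0 th : 0 <= u th by exact: (lossinf_ge0 _ _ _ _ xi).
set c := 4 * L.+1%:R * (1 - s * K).
have c0 : 0 < c by rewrite !mulr_gt0.
have TP th : V th <= V0 -> 1 + dot th th <= P.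
  by move=> hV; have := coer th; rewrite /P; lra.
have step n : V (Theta n) <= V0 ->
    V (Theta n.+1) <= V (Theta n) - c * (gamma n * u (Theta n)).
  move=> hV; rewrite Thetastep GE.
  exact: (Vfun_descent l L a b mu f xi mufin f_xi _ _ _ _ _ (g0 n) (hs n) (TP _ hV) hK).
(* The estimates of a step are valid on the sublevel set [V <= V0], and the step does not leave
   it. *)
have VV0 n : V (Theta n) <= V0.
  elim: n => [//|n IH]; apply: (le_trans (step n IH)).
  by rewrite (le_trans _ IH)// gerBl mulr_ge0 ?(ltW c0)// mulr_ge0.
split.
  apply: ge_ereal_sup => _ [n _ <-]; rewrite lee_fin ler_wsqrtr//.
  rewrite (_ : \sum_(i < _) _ = dot (Theta n) (Theta n)); last first.
    by apply: eq_bigr => i _; rewrite expr2.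
  by have := TP _ (VV0 n); rewrite /P; lra.
suff H : (fun n => u (Theta n)) @ \oo --> (0 : R).
  have HE : (fun n => (u (Theta n))%:E) @ \oo --> 0%E.
    by apply: cvg_EFin; [exact: nearW|exact: H].
  by have [_ ->] := cvg_limn_einf_sup HE.
(* The lower bound on [V] is [coer] combined with [dot >= 0]; the growth constant is that of
   [lossinf_growth]. *)
apply: (@descent_cvg0 R (fun n => V (Theta n)) _ gamma c (2 * L.+1%:R ^+ 2 * f0sq)
  (1 + (s + m) * (K * (4 * (K * m))))) => //.
- by rewrite addr_ge0// mulr_ge0 ?addr_ge0// !mulr_ge0// ltW.
- by move=> n; have := coer (Theta n); have := dot_ge0 _ (Theta n); lra.
- by move=> n; exact: step.
- move=> n; have := TP _ (VV0 n.+1); rewrite Thetastep GE => hP'.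
  exact: (lossinf_growth l L a b mu f xi mufin f_xi _ _ _ _ _ (g0 n) (hs n) (TP _ (VV0 n)) hP' hK).
Qed.
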